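(* Let $d\ge 2$, let $z_1,z_2,\dots,z_d>0$ be even integers, and let $b_1,\dots,b_{d-1}\ge 0$ be integers each of which is odd or $0$, such that for some $k\in\{1,\dots,d\}$: $b_j=\frac{z_j}{2}-1$ for all $1\le j<k-1$; if $k\ge2$, $b_{k-1}$ is odd with $0<b_{k-1}\le\frac{z_{k-1}}{2}-1$; and $b_j=0$ for all $k\le j\le d-1$. Let $A_3,\dots,A_{d+1}$ be the integers determined by $(z_j)$ and $(b_j)$ as defined in the context. If $d=2$, assume $4\mid z_d$ and $A_3\mid z_1$. If $d\ge 3$, assume $4\mid z_d$, $A_3\mid z_1$, and $2A_{j+2}\mid z_j$ for all $2\le j\le d-1$. Then the torus $C_{z_1}\square C_{z_d}$ (when $d=2$), $C_{z_1}\square C_{z_d}\square C_{z_2}$ (when $d=3$), $C_{z_1}\square C_{z_d}\square C_{z_2}\square\cdots\square C_{z_{d-1}}$ (when $d\ge4$) can be decomposed into $$2\prod_{k=0}^{d-2}\frac{z_{k+1}}{A_{k+3}}$$ cycles of length $$\frac{d\,z_d}{2}\prod_{k=0}^{d-2}A_{k+3},$$ each of which has the same number of edges, namely $\frac{z_d}{2}\prod_{k=0}^{d-2}A_{k+3}$, coming from each of the $d$ cycles defining the torus.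
   Context: For $b\ge 2$, $C_b$ denotes the cycle of length $b$ (for $b=2$: two vertices joined by two parallel edges); $\square$ is the Cartesian product of graphs. An edge of a product of cycles ''comes from'' a given factor if its endpoints differ in the coordinate of that factor. A graph $G$ is decomposed into subgraphs $H_1,\dots,H_m$ if $G=H_1\cup\cdots\cup H_m$ and the edge sets are pairwise disjoint. For integers $y,c$ put $\eta(y,c)=1$ if $y>c$ and $\eta(y,c)=0$ otherwise. Put $b_d=0$ and, for $1\le k\le d$, $$\alpha_k=z_d\prod_{j=0}^{k-2}\frac{z_{j+1}}{2}\quad(\text{so }\alpha_1=z_d),\qquad \eta_{\alpha_k}=\eta\Big(z_d(b_k+1)\prod_{j=0}^{k-2}\frac{z_{j+1}}{2},\ \alpha_k\Big).$$ Put $A_2=\eta(z_d(b_1+1)+1,\alpha_2)$, $A_3=(2(b_1+1))^{1-A_2}\,z_1^{A_2}$, and for $4\le k\le d+1$ $$A_k=(b_{k-2}+1)^{(1-\eta_{\alpha_{k-1}})\eta_{\alpha_{k-2}}}\Big(\frac{z_{k-2}}{2}\Big)^{\eta_{\alpha_{k-1}}}.$$ *)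

(* Defs.v *)
From mathcomp Require Import all_boot.

Set Implicit Arguments.
Unset Strict Implicit.
Unset Printing Implicit Defensive.

(* Finite multigraphs: [ends e] is the unordered set of endpoints of [e], and
   distinct edges may have the same endpoints. *)
Record mgraph := MGraph {
  vert : finType;
  edge : finType;
  ends : edge -> {set vert} }.

(* [ordS] is the cyclic successor, so edge [i] joins [i] and [i + 1 mod b]; for
   [b = 2] this gives two parallel edges.  Only [b >= 2] is meaningful. *)
Definition cyc (b : nat) : mgraph :=
  @MGraph 'I_b 'I_b (fun i => [set i; ordS i]).

Section CartesianProduct.
Variables (n : nat) (G : 'I_n -> mgraph).

Definition cart_vert : finType := {dffun forall i : 'I_n, vert (G i)}.

(* An edge of the product in direction [i] is an edge of the factor [G i]
   together with a vertex of every other factor [G (lift i j)]. *)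
Definition cart_edge_dir (i : 'I_n) : finType :=
  (edge (G i) * {dffun forall j : 'I_n.-1, vert (G (lift i j))})%type.

Definition cart_edge : finType := {i : 'I_n & cart_edge_dir i}.

Definition cart_ends (e : cart_edge) : {set cart_vert} :=
  [set v : cart_vert | (v (tag e) \in ends (tagged e).1) &&
     [forall j : 'I_n.-1, v (lift (tag e) j) == (tagged e).2 j]].

Definition cart : mgraph := MGraph cart_ends.

Definition comes_from (i : 'I_n) (e : edge cart) : bool :=
  [exists u : cart_vert, exists v : cart_vert,
     [&& u \in cart_ends e, v \in cart_ends e & u i != v i]].

End CartesianProduct.

Record subgraph (G : mgraph) := Subgraph {
  svert : {set vert G};
  sedge : {set edge G};
  _ : forall e, e \in sedge -> ends e \subset svert }.

Definition isomorphic_to (G : mgraph) (H : subgraph G) (K : mgraph) : Prop :=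
  exists (f : vert K -> vert G) (g : edge K -> edge G),
    [/\ injective f, injective g,
        svert H = [set f x | x : vert K],
        sedge H = [set g e | e : edge K]
      & forall e : edge K, ends (g e) = [set f x | x in ends e]].

Definition is_cycle (L : nat) (G : mgraph) (H : subgraph G) : Prop :=
  2 <= L /\ isomorphic_to H (cyc L).

Definition decomposition (G : mgraph) (m : nat) (H : 'I_m -> subgraph G) :
  Prop :=
  [/\ \bigcup_(i < m) svert (H i) = [set: vert G],
      \bigcup_(i < m) sedge (H i) = [set: edge G]
    & forall i j : 'I_m, i != j -> [disjoint sedge (H i) & sedge (H j)]].

(* Sequences such as z_1, ..., z_d are functions on [nat] of which only the
   values at the indices 1, ..., d are used. *)

(* C_{z_1} [] C_{z_d} [] C_{z_2} [] ... [] C_{z_{d-1}}: the factor z_d is in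
   second position. *)
Definition torus_len (d : nat) (z : nat -> nat) (i : nat) : nat :=
  match i with
  | 0 => z 1
  | 1 => z d
  | _ => z i
  end.

Definition torus (d : nat) (z : nat -> nat) : mgraph :=
  cart (fun i : 'I_d => cyc (torus_len d z i)).

Section Coefficients.
Variables (d : nat) (z b : nat -> nat).

Definition eta (y c : nat) : nat := if c < y then 1 else 0.

(* b_1, ..., b_{d-1} are given; b_d = 0 by convention. *)
Definition bx (k : nat) : nat := if k < d then b k else 0.

(* For 1 <= k, so that the product over 0 <= j <= k - 2 is over j < k.-1. *)
Definition half_prod (k : nat) : nat :=
  \prod_(0 <= j < k.-1) (z j.+1 %/ 2).

Definition alpha (k : nat) : nat := z d * half_prod k.

Definition eta_alpha (k : nat) : nat :=
  eta (z d * (bx k + 1) * half_prod k) (alpha k).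

Definition coefA2 : nat := eta (z d * (bx 1 + 1) + 1) (alpha 2).

Definition coefA3 : nat := (2 * (bx 1 + 1)) ^ (1 - coefA2) * z 1 ^ coefA2.

(* Meaningful for 3 <= k <= d + 1. *)
Definition coefA (k : nat) : nat :=
  if k == 3 then coefA3
  else (bx (k - 2) + 1) ^ ((1 - eta_alpha (k - 1)) * eta_alpha (k - 2))
       * (z (k - 2) %/ 2) ^ eta_alpha (k - 1).

End Coefficients.

(* Main.v *)
Require Import Defs.
From mathcomp Require Import all_boot.
From mathcomp Require Import fingroup perm.
From mathcomp Require Import zify.

(** Put [a_j = b_j + 1].  Because the [b_j] are full ([a_j = z_j / 2]) before
    the index [k - 1] and zero after it, every case of the definition of the
    coefficients gives the same value: [A_3 = 2 a_1] and [A_(j+2) = a_j] for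
    [j >= 2] ([coefA3E], [coefAE]).  The theorem therefore asks for
    [prod_(j < d) z_j / a_j] cycles with [z_d prod_(j < d) a_j] edges in each
    of the [d] directions, where every [a_j] is [1] or [z_j / 2] except for one
    direction [q], in which [a_q] is [1] or even and [2 a_q] divides [z_q]
    ([fair_torus_decomposition]).

    The directions other than [q] are handled by an explicit formula.  Call the
    direction of length [z_d] the first one.  A closed curve makes a stop at
    each time [k]; between two stops it takes one unit step, forwards or
    backwards, in each direction.  At time [k] the first coordinate is [k], and
    the coordinate [j] is [o_j + 2 c_j + (k mod 2)], where [c_j] is the digit
    of [k] for the radix [a_j] in the mixed radix system with radices [z_d] and
    then the [a_j], and where the offset [o_j < z_j / a_j] names the curve.
    Thus the coordinate [j] oscillates if [a_j = 1] and climbs slowly, by two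
    at each carry, if [a_j = z_j / 2].  The offset and the time, modulo the
    period [N = z_d prod a_j], can be read off the coordinates one digit after
    the other ([stop_decode], [stops_decode]); so the stops of all the curves
    partition the vertices of this smaller torus and the steps of each
    direction partition its edges.  A curve is simple because the parity of a
    coordinate shows whether it was last reached at an even or at an odd time
    ([node_inj]).

    To include [q], fix an offset.  The curve times [C_(z_q)] is a copy of the
    grid [C_N [] C_(z_q)], each horizontal edge being subdivided into one step
    for each of the other directions.  It remains to decompose that grid into
    [z_q / a_q] cycles, each with [N a_q] horizontal and [N a_q] vertical
    edges, and to substitute segments for horizontal edges ([walk_subst]).  If
    [a_q = 1] the cycles are zigzags between two consecutive rows
    ([zigzag_fair]).  If [a_q] is even each cycle is a Hamiltonian cycle of a
    band of [2 a_q] rows, made of copies of one block that is four columns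
    wide ([band_block], [band_fair]); the bands start at the multiples of
    [a_q], so that each row is shared by two of them, and every second one is
    reflected.  Here the divisibility hypotheses enter: [4] divides [N] because
    it divides [z_d], and the number [z_q / a_q] of bands is even.

    Finally, closed walks without repeated vertices or edges are cycles
    ([closed_walk_cycle]), and pairwise disjoint ones cover all the edges as
    soon as their lengths add up correctly ([decomposition_by_walks]). *)

Set Implicit Arguments.
Unset Strict Implicit.
Unset Printing Implicit Defensive.

(** * Walks, and grids in the plane *)

Section Walk.
Variables (V E : eqType) (src tgt : E -> V).
Implicit Types (d : bool * E) (s : seq (bool * E)) (u v w : V).

(** Darts, pairs of a boolean and an edge, are edges with a sense of travel:
    [true] goes from [src] to [tgt]. *)
Definition flip d := (~~ d.1, d.2).
Definition from d := if d.1 then src d.2 else tgt d.2.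
Definition into d := if d.1 then tgt d.2 else src d.2.

Fixpoint walk u s v :=
  if s is d :: s' then (from d == u) && walk (into d) s' v else u == v.

Lemma walk_cat u v w s1 s2 : walk u s1 v -> walk v s2 w -> walk u (s1 ++ s2) w.
Proof.
elim: s1 u => [|d s1 IH] u /=; first by move/eqP->.
by case/andP=> -> /IH{}IH /IH.
Qed.

Lemma walk_rev u v s : walk u s v -> walk v (rev (map flip s)) u.
Proof.
elim: s u => [|d s IH] u /=; first by rewrite eq_sym.
case/andP=> /eqP<- /IH w_s; rewrite rev_cons -cats1.
by apply: (walk_cat w_s); rewrite /from /into /flip /=; case: d.1; rewrite !eqxx.
Qed.

(** The default value [v] of [nth] is what makes this hold for the last dart. *)
Lemma from_nth d0 u v s k : walk u s v -> k < size s ->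
  into (nth d0 s k) = nth v (map from s) k.+1.
Proof.
elim: s u k => [|d s IH] u [|k] //= /andP[_ ws].
  by case: s ws {IH} => [/eqP|d' s /andP[/eqP]].
by move=> lt_k; rewrite (IH _ _ ws).
Qed.

Lemma walk_head d0 u v s : walk u s v -> 0 < size s -> from (nth d0 s 0) = u.
Proof. by case: s => //= d s /andP[/eqP]. Qed.

Lemma into_mem u v s d : walk u s v -> d \in s -> into d \in v :: map from s.
Proof.
move=> ws /(nthP d)[k lt_k <-]; rewrite (from_nth _ ws lt_k).
have [lt_k1|] := ltnP k.+1 (size s); first by rewrite inE mem_nth ?orbT ?size_map.
by move=> ge_k; rewrite nth_default ?mem_head ?size_map.
Qed.

End Walk.

Section Substitution.
Variables (V E V' E' : eqType) (src tgt : E -> V) (src' tgt' : E' -> V').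
Variables (phi : V -> V') (X : E -> seq (bool * E')).

Definition subst (d : bool * E) :=
  if d.1 then X d.2 else rev (map (@flip _) (X d.2)).

(** The step from the grid to the torus: there a horizontal edge of the grid
    becomes a path with one edge in each of several directions. *)
Lemma walk_subst u v s :
    (forall d, d \in s -> walk src' tgt' (phi (src d.2)) (X d.2) (phi (tgt d.2))) ->
  walk src tgt u s v ->
  walk src' tgt' (phi u) (flatten (map subst s)) (phi v).
Proof.
elim: s u => [|d s IH] u Xs /=; first by move/eqP->.
case/andP=> /eqP<- ws; have Xd := Xs d (mem_head d s).
apply: (@walk_cat _ _ _ _ _ (phi (into src tgt d))); last first.
  by apply: IH ws => e se; apply: Xs; rewrite inE se orbT.
rewrite /subst /from /into; case: d.1; first exact: Xd.
exact: walk_rev.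
Qed.

End Substitution.

(** The grid is unbounded, and [C_N [] C_z] is its quotient by [modv N z]; so
    closed walks that wind around can be written without wrapped indices.  The
    boolean of an edge is [true] for the vertical edge upwards from the given
    vertex, [false] for the horizontal edge to the right. *)
Definition gedge := (bool * (nat * nat))%type.
Definition gsrc (e : gedge) : nat * nat := e.2.
Definition gtgt (e : gedge) : nat * nat :=
  if e.1 then (e.2.1, e.2.2.+1) else (e.2.1.+1, e.2.2).
Notation gdart := (bool * gedge)%type.
Notation gwalk := (walk gsrc gtgt).
Notation gfrom := (from gsrc gtgt).
Notation ginto := (into gsrc gtgt).

Definition modv N z (v : nat * nat) := (v.1 %% N, v.2 %% z).
Definition mode N z (e : gedge) : gedge := (e.1, modv N z e.2).

(** The walks [W t], for [t < z / a], are the cycles of a decomposition of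
    [C_N [] C_z], each with [N a] edges in both directions. *)
Definition fair_grid N z a (W : nat -> seq gdart) : Prop :=
  [/\ forall t, t < z %/ a ->
        exists u v, gwalk u (W t) v /\ modv N z u = modv N z v,
      forall t, t < z %/ a -> uniq [seq modv N z (gfrom d) | d <- W t],
      forall t b, t < z %/ a -> count (fun d : gdart => d.2.1 == b) (W t) = N * a
    & uniq (flatten [seq [seq mode N z d.2 | d <- W t] | t <- iota 0 (z %/ a)]) ].

(** Counting turns covering into injectivity: the walks have together as many
    darts as [C_N [] C_z] has edges, and each one as many as a band of [2 a]
    rows has vertices.  So nothing can be met twice once everything is met. *)
Lemma fair_grid_by_covering N z a W :
    0 < N -> 0 < a -> 2 * a %| z -> 0 < z ->
    (forall t, t < z %/ a ->
        exists u v, gwalk u (W t) v /\ modv N z u = modv N z v) ->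
    (forall t b, t < z %/ a -> count (fun d : gdart => d.2.1 == b) (W t) = N * a) ->
    (forall b X Y, X < N -> Y < z -> exists2 t, t < z %/ a &
       (b, (X, Y)) \in [seq mode N z d.2 | d <- W t]) ->
    (forall t X r, t < z %/ a -> X < N -> r < 2 * a -> exists2 d, d \in W t &
       (X, (t * a + r) %% z) \in [:: modv N z (gsrc d.2); modv N z (gtgt d.2)]) ->
  fair_grid N z a W.
Proof.
move=> N0 a0 dv_az z0 closedW countW coverE coverV.
have sizeW t : t < z %/ a -> size (W t) = 2 * (N * a).
  move=> ltt; rewrite -(count_predC (fun d : gdart => d.2.1 == true)) countW //.
  rewrite (eq_count (a2 := fun d : gdart => d.2.1 == false)) ?countW //; first by lia.
  by case=> [? [[] ?]].
have az : a %| z by apply: dvdn_trans dv_az; rewrite dvdn_mull.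
have le_az : 2 * a <= z by apply: dvdn_leq.
split=> //.
- move=> t ltt; have [u [v [wW uv]]] := closedW t ltt.
  pose s1 := [seq (X, (t * a + r) %% z) | X <- iota 0 N, r <- iota 0 (2 * a)].
  apply: (@leq_size_uniq _ s1).
  + apply: allpairs_uniq; try exact: iota_uniq.
    move=> [X r] [X' r'] /allpairsP[[? ?] /= [_ +]] [-> ->] /allpairsP[[? ?] /= [_ +]] [-> ->].
    rewrite !mem_iota !add0n => /andP[_ ltr] /andP[_ ltr'] [-> /eqP].
    by rewrite eqn_modDl !modn_small ?(leq_trans _ le_az) // => /eqP->.
  + move=> p /allpairsP[[X r] /=]; rewrite !mem_iota => -[ltX ltr ->].
    have [d Wd] := coverV t X r ltt ltX ltr.
    have fromd : modv N z (gfrom d) \in [seq modv N z (gfrom d) | d <- W t].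
      by apply/mapP; exists d.
    have intod : modv N z (ginto d) \in [seq modv N z (gfrom d) | d <- W t].
      have := into_mem wW Wd; rewrite inE => /orP[/eqP->|/mapP[d' Wd' ->]]; last first.
        by apply/mapP; exists d'.
      rewrite -uv; case: (W t) wW Wd => //= d' s /andP[/eqP<- _] _.
      by rewrite mem_head.
    rewrite !inE => /orP[]/eqP->; move: fromd intod; rewrite /from /into;
      by case: d.1.
  rewrite size_map sizeW // size_allpairs !size_iota; lia.
pose pp := [seq (X, Y) | X <- iota 0 N, Y <- iota 0 z].
have uniqpp : uniq pp.
  by apply: allpairs_uniq; try exact: iota_uniq; move=> [? ?] [? ?] _ _ [-> ->].
apply: (@leq_size_uniq _ [seq (b, p) | b <- [:: true; false], p <- pp]).
- apply: allpairs_uniq => //; by move=> -[? ?] [? ?] _ _ [-> ->].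
- move=> e /allpairsP[[b p] /= [_ /allpairsP[[X Y] /=]]].
  rewrite !mem_iota => -[ltX ltY ->] ->.
  have [t ltt tW] := coverE b X Y ltX ltY; apply/flattenP.
  by exists [seq mode N z d.2 | d <- W t] => //; apply: map_f; rewrite mem_iota.
rewrite !size_allpairs !size_iota size_flatten /shape -map_comp.
have -> : [seq (size \o (fun t => [seq mode N z d.2 | d <- W t])) i | i <- iota 0 (z %/ a)]
    = nseq (z %/ a) (2 * (N * a)).
  apply: (@eq_from_nth _ 0) => [|i]; rewrite size_map size_iota ?size_nseq // => lti.
  by rewrite (nth_map 0) ?size_iota // nth_iota // nth_nseq lti /= size_map sizeW.
by rewrite sumn_nseq -{2}(divnK az) /=; nia.
Qed.

(** * Grids: zigzags between consecutive rows *)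

Lemma walk_blocks (V E : eqType) (src tgt : E -> V) (p : nat -> V) B n :
    (forall i, walk src tgt (p i) (B i) (p i.+1)) ->
  walk src tgt (p 0) (flatten [seq B i | i <- iota 0 n]) (p n).
Proof.
move=> wB; elim: n => [|n IH]; first exact: eqxx.
have -> : iota 0 n.+1 = iota 0 n ++ [:: n] by rewrite -addn1 iotaD.
by rewrite map_cat flatten_cat (walk_cat IH) //= cats0.
Qed.

Lemma count_blocks (T : Type) (P : pred T) (B : nat -> seq T) c n :
  (forall i, count P (B i) = c) -> count P (flatten [seq B i | i <- iota 0 n]) = n * c.
Proof.
move=> cB; elim: n => [|n IH] //.
have -> : iota 0 n.+1 = iota 0 n ++ [:: n] by rewrite -addn1 iotaD.
by rewrite map_cat flatten_cat count_cat IH /= cats0 cB; lia.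
Qed.

Lemma mem_blocks (T : eqType) (B : nat -> seq T) n i d :
  i < n -> d \in B i -> d \in flatten [seq B i | i <- iota 0 n].
Proof.
by move=> lt_i Bd; apply/flattenP; exists (B i) => //; apply: map_f; rewrite mem_iota.
Qed.

Definition north x y : gdart := (true, (true, (x, y))).
Definition south x y : gdart := (false, (true, (x, y))).
Definition east x y : gdart := (true, (false, (x, y))).
Definition west x y : gdart := (false, (false, (x, y))).

Section Zigzag.
Variables (N z : nat).
Hypotheses (N0 : 0 < N) (N2 : 2 %| N) (z0 : 0 < z) (z2 : 2 %| z).

(** Between the rows [t] and [t + 1]: all the vertical edges, and horizontal
    ones alternately in the upper and in the lower row.  The horizontal edges
    that are left out belong to the zigzags above and below. *)
Definition zigzag t : seq gdart :=
  flatten [seq [:: north (2 * i) t; east (2 * i) t.+1;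
                   south (2 * i).+1 t; east (2 * i).+1 t] | i <- iota 0 (N %/ 2)].

Lemma mem_zigzag t X : X < N ->
  (true, (X, t)) \in [seq d.2 | d <- zigzag t] /\
  (false, (X, t + ~~ odd X)) \in [seq d.2 | d <- zigzag t].
Proof.
move=> ltX; have lti : X %/ 2 < N %/ 2 by lia.
split; apply/mapP.
  exists (~~ odd X, (true, (X, t))) => //; apply: (mem_blocks lti).
  have [oX|eX] := boolP (odd X).
    have -> : (2 * (X %/ 2)).+1 = X by lia.
    by rewrite !inE /south eqxx !orbT.
  have -> : (2 * (X %/ 2)) = X by lia.
  by rewrite !inE /north eqxx.
exists (true, (false, (X, t + ~~ odd X))) => //; apply: (mem_blocks lti).
have [oX|eX] := boolP (odd X).
  have -> : (2 * (X %/ 2)).+1 = X by lia.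
  by rewrite !inE /east addn0 eqxx !orbT.
have -> : (2 * (X %/ 2)) = X by lia.
by rewrite !inE /east addn1 eqxx !orbT.
Qed.

Lemma zigzag_fair : fair_grid N z 1 zigzag.
Proof.
apply: fair_grid_by_covering => //; rewrite ?divn1.
- move=> t _; exists (0, t), (2 * (N %/ 2), t); split.
    have -> : (0, t) = (2 * 0, t) by [].
    apply: (walk_blocks (p := fun i => (2 * i, t))) => i.
    by rewrite /= /from /into /gsrc /gtgt /= !eqxx /=; apply/eqP; congr (_, _); lia.
  by rewrite /modv /= mulnC (divnK N2) modnn mod0n.
- move=> t b _; rewrite (count_blocks (c := 2)); first by case: b => /=; lia.
  by case: b.
- move=> b X Y ltX ltY.
  (* A horizontal edge at an even column is the upper one of its zigzag. *)
  pose t := if b || odd X then Y else if Y == 0 then z.-1 else Y.-1.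
  have ltt : t < z by rewrite /t; case: (b || odd X) => //; case: (Y =P 0); lia.
  exists t => //; have [Vt Ht] := mem_zigzag t ltX.
  rewrite map_comp; apply/mapP.
  exists (b, (X, if b then t else t + ~~ odd X)); first by clearbody t; case: b Vt Ht.
  rewrite /mode /modv /= modn_small //; congr (_, (_, _)).
  rewrite /t {Vt Ht ltt t}; case: b => /=; first by rewrite modn_small.
  case: (odd X) => /=; first by rewrite addn0 modn_small.
  by case: (Y =P 0) => Y0; [rewrite Y0 addn1 prednK ?modnn | rewrite addn1 prednK ?modn_small //; lia].
- move=> t X r ltt ltX ltr; have [/mapP[d Wd dV] _] := mem_zigzag t ltX.
  exists d => //; rewrite -dV /modv /gsrc /gtgt /= muln1 (modn_small ltX) !inE.
  have [->|->] : r = 0 \/ r = 1 by lia.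
    by rewrite addn0 eqxx.
  by rewrite addn1 eqxx orbT.
Qed.

End Zigzag.

(** * Grids: a block of the even bands *)

Definition column x y l : seq gdart := [seq north x (y + i) | i <- iota 0 l].

Lemma walk_column x y l : gwalk (x, y) (column x y l) (x, y + l).
Proof.
elim: l => [|l IH]; first by rewrite /= addn0.
have -> : column x y l.+1 = column x y l ++ [:: north x (y + l)].
  by rewrite /column -addn1 iotaD map_cat.
by apply: walk_cat IH _; rewrite /= /from /into /gsrc /gtgt /= addnS !eqxx.
Qed.

Lemma count_column x y l b :
  count (fun d : gdart => d.2.1 == b) (column x y l) = if b then l else 0.
Proof.
rewrite count_map (eq_count (a2 := fun=> b)); last by case: b.
by case: b; rewrite ?count_predT ?count_pred0 ?size_iota.
Qed.

(** From [(0, 2 k)] down to [(0, 0)] through the columns 0, 1, 2, two rows for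
    each step of the recursion. *)
Fixpoint lower_serpentine k : seq gdart :=
  if k is k'.+1 then
    [:: east 0 (2 * k').+2; east 1 (2 * k').+2; south 2 (2 * k').+1;
        west 1 (2 * k').+1; west 0 (2 * k').+1; south 0 (2 * k')]
    ++ lower_serpentine k'
  else [::].

(** The image of [lower_serpentine] under a half turn of the band, traversed in
    the opposite sense. *)
Fixpoint upper_serpentine y k : seq gdart :=
  if k is k'.+1 then
    [:: south 4 (y + (2 * k').+2); west 3 (y + (2 * k').+2); west 2 (y + (2 * k').+2);
        south 2 (y + (2 * k').+1); east 2 (y + (2 * k').+1); east 3 (y + (2 * k').+1)]
    ++ upper_serpentine y k'
  else [::].

Ltac walk_tac := rewrite /= ?/from ?/into ?/gsrc ?/gtgt /=;
  repeat (apply/andP; split); rewrite ?eqxx //; try (apply/eqP; first [congr pair; lia | rewrite /=; lia]).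

Lemma walk_lower_serpentine k : gwalk (0, 2 * k) (lower_serpentine k) (0, 0).
Proof.
elim: k => [|k IH]; first by [].
apply: walk_cat IH; walk_tac.
Qed.

Lemma walk_upper_serpentine y k :
  gwalk (4, y + (2 * k).+1) (upper_serpentine y k) (4, y.+1).
Proof.
elim: k => [|k IH]; first by rewrite /= addn1.
apply: walk_cat IH; walk_tac.
Qed.

Lemma count_lower_serpentine k b :
  count (fun d : gdart => d.2.1 == b) (lower_serpentine k) = k * (if b then 2 else 4).
Proof. by elim: k => //= k ->; case: b => /=; lia. Qed.

Lemma count_upper_serpentine y k b :
  count (fun d : gdart => d.2.1 == b) (upper_serpentine y k) = k * (if b then 2 else 4).
Proof. by elim: k => //= k ->; case: b => /=; lia. Qed.

Lemma lower_serpentine_edges k r : r < 2 * k ->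
  [/\ (true, (if odd r then 2 else 0, r)) \in [seq d.2 | d <- lower_serpentine k],
      (false, (0, r.+1)) \in [seq d.2 | d <- lower_serpentine k]
    & (false, (1, r.+1)) \in [seq d.2 | d <- lower_serpentine k]].
Proof.
elim: k => // k IH ltr; rewrite /= !inE.
have [/IH[-> -> ->]|ger] := ltnP r (2 * k); first by rewrite !orbT.
have [->|->] : r = 2 * k \/ r = (2 * k).+1 by lia.
  have -> : odd (2 * k) = false by lia.
  by rewrite !eqxx ?orbT.
have -> : odd (2 * k).+1 by lia.
by rewrite !eqxx ?orbT.
Qed.

Lemma upper_serpentine_edges y k r : r < 2 * k ->
  [/\ (true, (if odd r then 4 else 2, y + r.+1)) \in [seq d.2 | d <- upper_serpentine y k],
      (false, (2, y + r.+1)) \in [seq d.2 | d <- upper_serpentine y k]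
    & (false, (3, y + r.+1)) \in [seq d.2 | d <- upper_serpentine y k]].
Proof.
elim: k => // k IH ltr; rewrite /= !inE.
have [/IH[-> -> ->]|ger] := ltnP r (2 * k); first by rewrite !orbT.
have [->|->] : r = 2 * k \/ r = (2 * k).+1 by lia.
  have -> : odd (2 * k) = false by lia.
  by rewrite !eqxx ?orbT.
have -> : odd (2 * k).+1 by lia.
by rewrite !eqxx ?orbT.
Qed.

Lemma lt4_cases c : c < 4 -> c = 0 \/ c = 1 \/ c = 2 \/ c = 3.
Proof. lia. Qed.

Section Band.
Variable m : nat.
Let a := (2 * m).+2.

(** The part of a band cycle that meets four consecutive columns, for
    [a = 2 m + 2]; the rows are numbered from 0 to [2 a - 1].  It starts at the
    top of the lower half of the band in column 0, winds down through the
    columns 0 to 2 and returns upwards along column 3; it crosses the middle of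
    the band four times, picking up one horizontal edge in each of the two
    middle rows; in the upper half it rises along column 1 and winds down
    through the columns 2 to 4; it ends in column 4 at the height of its start.

    The lower half uses the edges that the upper half of the band below leaves
    free, provided that one of the two bands is reflected by [x |-> 2 - x].
    This reflection also is what joins the two halves into one single cycle
    instead of several. *)
Definition band_block : seq gdart :=
  [:: south 0 (2 * m)] ++ lower_serpentine m
  ++ [:: east 0 0; east 1 0; east 2 0] ++ column 3 0 (2 * m).+1
  ++ [:: north 3 (2 * m).+1; west 2 a; south 2 (2 * m).+1;
         west 1 (2 * m).+1; north 1 (2 * m).+1]
  ++ column 1 a (2 * m).+1
  ++ [:: east 1 (a + (2 * m).+1); east 2 (a + (2 * m).+1); east 3 (a + (2 * m).+1)]
  ++ upper_serpentine a m
  ++ [:: south 4 a; south 4 (2 * m).+1].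

Lemma walk_band_block : gwalk (0, (2 * m).+1) band_block (4, (2 * m).+1).
Proof.
apply: (@walk_cat _ _ _ _ _ (0, 2 * m)); first by walk_tac.
apply: walk_cat (walk_lower_serpentine m) _.
apply: (@walk_cat _ _ _ _ _ (3, 0)); first by walk_tac.
apply: walk_cat (walk_column 3 0 _) _.
apply: (@walk_cat _ _ _ _ _ (1, a)); first by rewrite add0n; walk_tac.
apply: walk_cat (walk_column 1 a _) _.
apply: (@walk_cat _ _ _ _ _ (4, a + (2 * m).+1)); first by walk_tac.
apply: walk_cat (walk_upper_serpentine a m) _.
by walk_tac.
Qed.

Lemma count_band_block b : count (fun d : gdart => d.2.1 == b) band_block = 4 * a.
Proof.
rewrite /band_block !count_cat count_lower_serpentine count_upper_serpentine.
by rewrite !count_column; case: b => /=; rewrite /a; lia.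
Qed.

Local Notation edges := [seq d.2 | d <- band_block].

Let edge_cat e s1 s2 :
  (e \in [seq d.2 | d <- s1 ++ s2]) =
  (e \in [seq (d : gdart).2 | d <- s1]) || (e \in [seq d.2 | d <- s2]).
Proof. by rewrite map_cat mem_cat. Qed.

Lemma mem_column_edges x y l h : y <= h < y + l ->
  (true, (x, h)) \in [seq d.2 | d <- column x y l].
Proof.
move=> h_int; apply/mapP; exists (north x h) => //; apply/mapP; exists (h - y).
  by rewrite mem_iota; lia.
by rewrite /north subnKC //; lia.
Qed.

Lemma band_lower_edges r : r <= 2 * m ->
  [/\ (true, (if odd r then 2 else 0, r)) \in edges, (true, (3, r)) \in edges,
      (false, (0, r)) \in edges & (false, (1, r)) \in edges].
Proof.
move=> ler; rewrite /band_block !edge_cat (@mem_column_edges 3 0 (2 * m).+1 r) ?orbT //.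
case: (ltnP r (2 * m)) => [/lower_serpentine_edges[-> _ _]|ger]; rewrite ?orbT.
  by case: r ler => [|r] ler; last have [_ -> ->] := lower_serpentine_edges ler;
     rewrite ?orbT //= !inE !eqxx ?orbT.
have -> : r = 2 * m by lia.
have -> : odd (2 * m) = false by lia.
rewrite /= !inE !eqxx /=.
case: {ler ger} m => [|k]; first by rewrite !eqxx ?orbT.
have ltk : (2 * k).+1 < 2 * k.+1 by lia.
have [_] := lower_serpentine_edges ltk.
have -> : (2 * k).+2 = 2 * k.+1 by lia.
by move=> -> ->; rewrite ?orbT.
Qed.

Lemma band_upper_edges h : h <= 2 * m ->
  [/\ (true, (if odd h then 2 else 4, a + h)) \in edges, (true, (1, a + h)) \in edges,
      (false, (2, a + h.+1)) \in edges & (false, (3, a + h.+1)) \in edges].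
Proof.
move=> leh; rewrite /band_block !edge_cat.
rewrite (@mem_column_edges 1 a (2 * m).+1 (a + h)) ?orbT; last by lia.
split=> //.
- case: h leh => [|h] leh; first by rewrite addn0 /= !inE eqxx ?orbT.
  have [+ _ _] := upper_serpentine_edges a leh.
  by rewrite /=; case: (odd h) => /= ->; rewrite ?orbT.
- case: (ltnP h (2 * m)) => [/(upper_serpentine_edges a)[_ -> _]|geh]; rewrite ?orbT //.
  have -> : h = 2 * m by lia.
  by rewrite /= !inE !eqxx ?orbT.
case: (ltnP h (2 * m)) => [/(upper_serpentine_edges a)[_ _ ->]|geh]; rewrite ?orbT //.
have -> : h = 2 * m by lia.
by rewrite /= !inE !eqxx ?orbT.
Qed.

Lemma band_middle_edges c : 0 < c <= 4 -> (true, (c, (2 * m).+1)) \in edges.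
Proof.
move: c => [|[|[|[|[|c]]]]] // _;
  by rewrite /band_block !edge_cat /= !inE !eqxx ?orbT.
Qed.

Lemma band_special_edges :
  [/\ (false, (2, 0)) \in edges, (false, (1, (2 * m).+1)) \in edges,
      (false, (2, a)) \in edges & (false, (1, a + (2 * m).+1)) \in edges].
Proof. by rewrite /band_block !edge_cat /= !inE !eqxx ?orbT. Qed.

(** The edges of [a] consecutive rows are shared between the lower half of a
    band and the upper half of the band below, which is reflected: a vertical
    edge in column [c] comes from column [2 - c] there, and a horizontal one
    starting in column [c] from one starting in column [1 - c]. *)
Lemma band_block_covers b c r : c < 4 -> r < a -> exists c',
  (c' = c %[mod 4] /\ (b, (c', r)) \in edges) \/
  (c' + c = (if b then 2 else 1) %[mod 4] /\ (b, (c', a + r)) \in edges).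
Proof.
move=> ltc ltr; have V1 := @band_middle_edges 1 isT; have V2 := @band_middle_edges 2 isT.
have V3 := @band_middle_edges 3 isT; have V4 := @band_middle_edges 4 isT.
have [H2 H1 H2' H1'] := band_special_edges.
have [ler|ger] := leqP r (2 * m).
  have [L02 L3 H0 H1l] := band_lower_edges ler.
  have [U24 U1 _ _] := band_upper_edges ler.
  case: b.
    have [->|[->|[->|->]]] : c = 0 \/ c = 1 \/ c = 2 \/ c = 3 by exact: lt4_cases.
    - by case: (odd r) L02 U24 => L02 U24; [exists 2; right | exists 0; left].
    - by exists 1; right.
    - by case: (odd r) L02 U24 => L02 U24; [exists 2; left | exists 4; right].
    - by exists 3; left.
  have [->|[->|[->|->]]] : c = 0 \/ c = 1 \/ c = 2 \/ c = 3 by exact: lt4_cases.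
  - by exists 0; left.
  - by exists 1; left.
  - case: r ler H0 H1l ltr {U24 U1 L02 L3} => [|h] leh _ _ _; first by exists 2; left.
    by exists 3; right; have [//|_ _ _ ->] := @band_upper_edges h; first exact: ltnW.
  case: r ler H0 H1l ltr {U24 U1 L02 L3} => [|h] leh _ _ _.
    by exists 2; right; rewrite addn0.
  by exists 2; right; have [//|_ _ -> _] := @band_upper_edges h; first exact: ltnW.
have -> : r = (2 * m).+1 by clear -ltr ger; lia.
case: b.
  have [->|[->|[->|->]]] : c = 0 \/ c = 1 \/ c = 2 \/ c = 3 by exact: lt4_cases.
  - by exists 4; left.
  - by exists 1; left.
  - by exists 2; left.
  - by exists 3; left.
have [//|_ _ U2 U3] := @band_upper_edges (2 * m).
have [->|[->|[->|->]]] : c = 0 \/ c = 1 \/ c = 2 \/ c = 3 by exact: lt4_cases.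
- by exists 1; right.
- by exists 1; left.
- by exists 3; right.
- by exists 2; right.
Qed.

Lemma band_block_visits c y : c < 4 -> y < 2 * a -> exists c' e,
  [/\ e \in edges, c' <= 4, c' = c %[mod 4] & (c', y) \in [:: gsrc e; gtgt e]].
Proof.
move=> ltc lty; have V1 := @band_middle_edges 1 isT; have V2 := @band_middle_edges 2 isT.
have V3 := @band_middle_edges 3 isT; have V4 := @band_middle_edges 4 isT.
rewrite /gsrc /gtgt.
have [ler|ger] := leqP y (2 * m).
  have [_ L3 H0 H1] := band_lower_edges ler.
  have [->|[->|[->|->]]] : c = 0 \/ c = 1 \/ c = 2 \/ c = 3 by exact: lt4_cases.
  - by exists 0, (false, (0, y)); rewrite H0 !inE !eqxx.
  - by exists 1, (false, (1, y)); rewrite H1 !inE !eqxx.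
  - by exists 2, (false, (1, y)); rewrite H1 !inE !eqxx orbT.
  - by exists 3, (true, (3, y)); rewrite L3 !inE !eqxx.
have [le_c|gt_c] := leqP y a.
  have [->|->] : y = (2 * m).+1 \/ y = a by clear -ger le_c; lia.
    have [->|[->|[->|->]]] : c = 0 \/ c = 1 \/ c = 2 \/ c = 3 by exact: lt4_cases.
    - by exists 4, (true, (4, (2 * m).+1)); rewrite V4 !inE !eqxx.
    - by exists 1, (true, (1, (2 * m).+1)); rewrite V1 !inE !eqxx.
    - by exists 2, (true, (2, (2 * m).+1)); rewrite V2 !inE !eqxx.
    - by exists 3, (true, (3, (2 * m).+1)); rewrite V3 !inE !eqxx.
  have [->|[->|[->|->]]] : c = 0 \/ c = 1 \/ c = 2 \/ c = 3 by exact: lt4_cases.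
  - by exists 4, (true, (4, (2 * m).+1)); rewrite V4 !inE !eqxx orbT.
  - by exists 1, (true, (1, (2 * m).+1)); rewrite V1 !inE !eqxx orbT.
  - by exists 2, (true, (2, (2 * m).+1)); rewrite V2 !inE !eqxx orbT.
  - by exists 3, (true, (3, (2 * m).+1)); rewrite V3 !inE !eqxx orbT.
have [h [leh ->]] : exists h, h <= 2 * m /\ y = a + h.+1.
  by clear -gt_c lty; exists (y - a).-1; split; lia.
have [_ U1 U2 U3] := band_upper_edges leh.
have [->|[->|[->|->]]] : c = 0 \/ c = 1 \/ c = 2 \/ c = 3 by exact: lt4_cases.
- by exists 4, (false, (3, a + h.+1)); rewrite U3 !inE !eqxx orbT.
- by exists 1, (true, (1, a + h)); rewrite U1 !inE -addnS !eqxx orbT.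
- by exists 2, (false, (2, a + h.+1)); rewrite U2 !inE !eqxx.
- by exists 3, (false, (3, a + h.+1)); rewrite U3 !inE !eqxx.
Qed.

End Band.

(** * Grids: Hamiltonian cycles of overlapping bands *)

Lemma walk_map (V E V' E' : eqType) (src tgt : E -> V) (src' tgt' : E' -> V')
    (phi : V -> V') (g : bool * E -> bool * E') u v s :
    (forall d, d \in s -> from src' tgt' (g d) = phi (from src tgt d) /\
                          into src' tgt' (g d) = phi (into src tgt d)) ->
  walk src tgt u s v -> walk src' tgt' (phi u) (map g s) (phi v).
Proof.
elim: s u => [|d s IH] u gs /=; first by move/eqP->.
case/andP=> /eqP<- ws; have [-> ->] := gs d (mem_head d s); rewrite eqxx /=.
by apply: IH ws => e se; apply: gs; rewrite inE se orbT.
Qed.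

Lemma band_block_narrow m d : d \in band_block m -> d.2.2.1 <= 4.
Proof.
apply: (allP (a := fun d : gdart => d.2.2.1 <= 4)).
have lowerP k : all (fun d : gdart => d.2.2.1 <= 4) (lower_serpentine k).
  by elim: k.
have upperP y k : all (fun d : gdart => d.2.2.1 <= 4) (upper_serpentine y k).
  by elim: k.
have columnP x y l : x <= 4 -> all (fun d : gdart => d.2.2.1 <= 4) (column x y l).
  by move=> lex; apply/allP=> _ /mapP[i _ ->].
by rewrite /band_block !all_cat lowerP upperP !columnP.
Qed.

Section Bands.
Variables (N z m : nat).
Let a := (2 * m).+2.
Hypotheses (N0 : 0 < N) (N4 : 4 %| N) (z0 : 0 < z) (az : 2 * a %| z).

Definition translate k (d : gdart) : gdart := (d.1, (d.2.1, (d.2.2.1 + k, d.2.2.2))).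

Definition base_band : seq gdart :=
  flatten [seq [seq translate (4 * i) d | d <- band_block m] | i <- iota 0 (N %/ 4)].

(** The band [t] starts at row [t a]; for odd [t] it is reflected by
    [x |-> N + 2 - x].  Since [4] divides [N], the reflection respects residues
    modulo 4. *)
Definition place_vertex t (v : nat * nat) : nat * nat :=
  (if odd t then N.+2 - v.1 else v.1, t * a + v.2).

(** A reflected horizontal edge is named by its other end and traversed in the
    opposite sense. *)
Definition place t (d : gdart) : gdart :=
  (d.1 (+) (odd t && ~~ d.2.1),
   (d.2.1, (if odd t then N + (if d.2.1 then 2 else 1) - d.2.2.1 else d.2.2.1,
            t * a + d.2.2.2))).

Definition band t : seq gdart := map (place t) base_band.

Lemma walk_base_band : gwalk (0, (2 * m).+1) base_band (N, (2 * m).+1).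
Proof.
have -> : (N, (2 * m).+1) = (4 * (N %/ 4), (2 * m).+1) by rewrite (mulnC 4) divnK.
apply: (walk_blocks (p := fun i => (4 * i, (2 * m).+1))) => i.
have -> : (4 * i.+1, (2 * m).+1) = (4 + 4 * i, (2 * m).+1) by congr pair; lia.
apply: (walk_map (phi := fun v => (v.1 + 4 * i, v.2)) _ (walk_band_block m)).
by move=> [[] [[] [x y]]] _; rewrite /from /into /gsrc /gtgt /= ?addSn.
Qed.

Lemma base_band_narrow d : d \in base_band -> d.2.2.1 <= N.
Proof.
case/flattenP=> _ /mapP[i ltiN ->] /mapP[d' /band_block_narrow le4 ->] /=.
by apply: leq_trans (leq_add le4 (leqnn _)) _; move: ltiN; rewrite mem_iota; lia.
Qed.

Lemma place_from t d : d.2.2.1 <= N ->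
  gfrom (place t d) = place_vertex t (gfrom d) /\
  ginto (place t d) = place_vertex t (ginto d).
Proof.
case: d => [s [b [x y]]] /=; rewrite /place /place_vertex /from /into /gsrc /gtgt /= => lex.
case: (odd t) b s => [] [] [] /=; split; congr pair; lia.
Qed.

Lemma walk_band t :
  gwalk (place_vertex t (0, (2 * m).+1)) (band t) (place_vertex t (N, (2 * m).+1)).
Proof.
by apply: walk_map walk_base_band => d /base_band_narrow; apply: place_from.
Qed.

Lemma count_band t b : count (fun d : gdart => d.2.1 == b) (band t) = N * a.
Proof.
rewrite count_map (eq_count (a2 := fun d : gdart => d.2.1 == b)) //.
rewrite (count_blocks (c := 4 * a)); first by rewrite mulnA divnK.
by move=> i; rewrite count_map -(count_band_block m b); apply: eq_count.
Qed.

(** The columns in the class of [c] modulo 4 are all reached by translating the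
    block, also after a reflection.  The constant [k] is 2 for vertices and
    vertical edges, and 1 for horizontal edges. *)
Lemma block_choice t k c X : X < N -> c <= 4 -> 0 < k ->
    (if odd t then c + X = k %[mod 4] else c = X %[mod 4]) ->
  exists i, [/\ i < N %/ 4, c + 4 * i <= N &
    (if odd t then N + k - (c + 4 * i) else c + 4 * i) = X %[mod N]].
Proof.
move=> ltX lec k0 cX; pose q := N %/ 4; have NE : N = q * 4 by rewrite divnK.
pose Z := if odd t then 2 * N + k - X - c else X + N - c.
have Z4 : 4 %| Z.
  by rewrite /Z; clearbody q; move: cX; case: (odd t) => cX; clear Z az z0; lia.
pose Y := Z %% N.
have Y4 : 4 %| Y by rewrite /Y /dvdn modn_dvdm.
have ltY : Y < N by rewrite ltn_mod.
have EY : 4 * (Y %/ 4) = Y by rewrite mulnC divnK.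
have leYN : c + Y <= N by clearbody q Y; clear -lec Y4 ltY NE; lia.
have leY : c + Y <= N + k by rewrite (leq_trans leYN) ?leq_addr.
exists (Y %/ 4); rewrite EY; split=> //; first by rewrite ltn_divLR ?divnK.
have YZ : Y = Z %[mod N] by rewrite modn_mod.
move: YZ; rewrite /Z; case: (odd t) => YZ; last first.
  by rewrite -modnDmr YZ modnDmr subnKC ?modnDr //; clear YZ leY leYN; lia.
apply/eqP; rewrite -(eqn_modDr (c + Y)) subnK // eq_sym addnA -modnDmr YZ modnDmr.
have -> : X + c + (2 * N + k - X - c) = N + (N + k) by clear YZ leY leYN; lia.
by rewrite modnDl.
Qed.

Lemma mem_base_band i d : i < N %/ 4 -> d \in band_block m ->
  translate (4 * i) d \in base_band.
Proof. by move=> lti Bd; apply: (mem_blocks lti); apply: map_f. Qed.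

Lemma mem_band t b c X y : X < N -> c <= 4 ->
    (b, (c, y)) \in [seq d.2 | d <- band_block m] ->
    (if odd t then c + X = (if b then 2 else 1) %[mod 4] else c = X %[mod 4]) ->
  exists2 d, d \in band t & [/\ d.2.1 = b, d.2.2.1 = X %[mod N] & d.2.2.2 = t * a + y].
Proof.
move=> ltX lec /mapP[[s e] /= Bd Ee]; subst e.
have k0 : 0 < (if b then 2 else 1) by case: (b).
case/(block_choice ltX lec k0) => i [lti _ EX].
exists (place t (translate (4 * i) (s, (b, (c, y))))) => //.
by apply: map_f; apply: mem_base_band.
Qed.

Lemma band_visits t X r : X < N -> r < 2 * a -> exists2 d, d \in band t &
  (X, (t * a + r) %% z) \in [:: modv N z (gsrc d.2); modv N z (gtgt d.2)].
Proof.
move=> ltX ltr.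
pose c := if odd t then (4 * N + 2 - X) %% 4 else X %% 4.
have ltc : c < 4 by rewrite /c; case: ifP; rewrite ltn_mod.
have [c' [e [/mapP[d Bd ->] le4 Ec' Vd]]] := band_block_visits ltc ltr.
have [|i [lti le_cN EX]] := @block_choice t 2 c' X ltX le4 isT.
  move: Ec'; rewrite /c; case: (odd t); last by rewrite modn_mod.
  move=> Ec'; rewrite -modnDml Ec' modn_mod modnDml subnK; last by clear -ltX; lia.
  by rewrite mulnC modnMDl.
have Wd := mem_base_band lti Bd.
have [Ef Ei] := place_from t (base_band_narrow Wd).
exists (place t (translate (4 * i) d)); first exact: map_f.
have -> : (X, (t * a + r) %% z) = modv N z (place_vertex t (c' + 4 * i, r)).
  by rewrite /place_vertex /modv /= -(addn2 N) EX (modn_small ltX).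
have: place_vertex t (c' + 4 * i, r) \in [:: gfrom (place t (translate (4 * i) d));
        ginto (place t (translate (4 * i) d))].
  rewrite Ef Ei; move: Vd {Wd Bd Ef Ei}.
  case: d => [s [b [x y]]]; rewrite /from /into /gsrc /gtgt /= !inE.
  by case: s b => [] [] /orP[]/eqP[-> ->]; rewrite ?addSn eqxx ?orbT.
rewrite !inE => /orP[]/eqP->; rewrite /from /into;
  by case: (place _ _).1; rewrite eqxx ?orbT.
Qed.

Lemma band_edge_narrow e : e \in [seq d.2 | d <- band_block m] -> e.2.1 <= 4.
Proof. by case/mapP=> d /band_block_narrow le4 ->. Qed.

(** An edge in the row [Y] lies in the lower half of the band [Y / a] or in the
    upper half of the band before it, which is a band of the other parity
    because the number [z / a] of bands is even. *)
Lemma band_fair : fair_grid N z a band.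
Proof.
have a_dv : a %| z by apply: dvdn_trans az; rewrite dvdn_mull.
have Ta : z %/ a * a = z by rewrite divnK.
have T0 : 0 < z %/ a by rewrite divn_gt0 // (dvdn_leq z0 a_dv).
have T2 : ~~ odd (z %/ a).
  have -> : z %/ a = (z %/ (2 * a)).*2; last by rewrite odd_double.
  rewrite -[in LHS](divnK az) mulnA mulnK // muln2 //.
have par k X c c' : 0 < k -> X < N ->
    c = (4 * N + k - X) %% 4 -> c' = c %[mod 4] -> c' + X = k %[mod 4].
  move=> k0 ltX -> Ec; rewrite -modnDml Ec modn_mod modnDml subnK; last by clear -ltX; lia.
  by rewrite mulnC modnMDl.
have par' k X c c' : 0 < k -> X < N ->
    c = (4 * N + k - X) %% 4 -> c' + c = k %[mod 4] -> c' = X %[mod 4].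
  move=> k0 ltX -> Ec; apply/eqP; rewrite -(eqn_modDr (4 * N + k - X)).
  rewrite -modnDmr Ec subnKC; last by clear -ltX; lia.
  by rewrite mulnC modnMDl.
apply: fair_grid_by_covering => //.
- move=> t _; eexists; eexists; split; first exact: walk_band.
  rewrite /place_vertex /modv /=; case: (odd t); last by rewrite modnn mod0n.
  by rewrite subn0 -addn2 modnDl (addnC N) addnK.
- by move=> t b _; apply: count_band.
- move=> b X Y ltX ltY; pose tau := Y %/ a; pose k := if b then 2 else 1.
  have k0 : 0 < k by rewrite /k; case: (b).
  have lt_tau : tau < z %/ a by rewrite /tau ltn_divLR // Ta.
  have EY : tau * a + Y %% a = Y by rewrite /tau -divn_eq.
  pose c := if odd tau then (4 * N + k - X) %% 4 else X %% 4.
  have ltc : c < 4 by rewrite /c; case: ifP; rewrite ltn_mod.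
  have ltr : Y %% a < a by rewrite ltn_mod.
  have [c' [[Ec' Bc']|[Ec' Bc']]] := band_block_covers b ltc ltr.
    have [] := mem_band (t := tau) ltX (band_edge_narrow Bc') Bc'.
      rewrite -/k; move: Ec'; rewrite /c; case: (odd tau); first exact: par.
      by rewrite modn_mod.
    move=> d Wd [Eb EX Ey]; exists tau => //; apply/mapP; exists d => //.
    by rewrite /mode /modv Eb EX Ey EY !modn_small.
  (* Going upwards, the band before the first one is the last one. *)
  pose t := if tau == 0 then (z %/ a).-1 else tau.-1.
  have ltt : t < z %/ a by rewrite /t; case: (tau =P 0); lia.
  have odd_t : odd t = ~~ odd tau.
    by rewrite /t; case: (tau =P 0) => [->|]; [|]; [clear -T0 T2|clear -lt_tau]; lia.
  have Et : t * a + (a + Y %% a) = Y %[mod z].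
    rewrite addnA -mulSnr /t; case: (tau =P 0) => [tau0|tau0].
      by rewrite prednK // Ta modnDl; rewrite -[in RHS]EY tau0.
    by rewrite prednK ?lt0n ?EY //; apply/eqP.
  have [] := mem_band (t := t) ltX (band_edge_narrow Bc') Bc'.
    rewrite -/k odd_t; move: Ec'; rewrite /c -/k; case: (odd tau) => /=; first exact: par'.
    by rewrite -modnDmr modn_mod modnDmr.
  move=> d Wd [Eb EX Ey]; exists t => //; apply/mapP; exists d => //.
  by rewrite /mode /modv Eb EX Ey Et !modn_small.
by move=> t X r _; apply: band_visits.
Qed.

End Bands.

(** * Cycles in a Cartesian product of cycles *)

Lemma card_dffun_prod (I : finType) (T : I -> finType) :
  #|{: {dffun forall i, T i}}| = \prod_i #|T i|.
Proof. by rewrite card_dep_ffun foldrE big_map big_enum. Qed.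

Section Torus.
Variables (d : nat) (len : 'I_d -> nat).
Hypothesis len_gt1 : forall i, 1 < len i.
Local Notation G := (fun i : 'I_d => cyc (len i)).
Local Notation V := (cart_vert G).

Lemma len_gt0 i : 0 < len i. Proof. exact: ltnW. Qed.

Definition torus_vertex (x : 'I_d -> nat) : V :=
  [ffun i => Ordinal (ltn_pmod (x i) (len_gt0 i)) : vert (G i)].

Lemma torus_vertexP x y :
  torus_vertex x = torus_vertex y <-> forall i, x i = y i %[mod len i].
Proof.
split=> [/ffunP Exy i|Exy]; first by have := Exy i; rewrite !ffunE => -[].
by apply/ffunP => i; rewrite !ffunE; apply: val_inj; apply: Exy.
Qed.

(** An edge of the torus is determined by its direction and by the vertex from
    which it goes one step forwards, also on a side of length 2, where the
    steps forwards from either end are the two parallel edges. *)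
Definition tedge := ('I_d * V)%type.
Definition tsrc (e : tedge) : V := e.2.
Definition ttgt (e : tedge) : V :=
  [ffun k => if k == e.1 then ordS (e.2 k) : vert (G k) else e.2 k].

Definition edge_of (e : tedge) : cart_edge G :=
  Tagged (cart_edge_dir G)
    ((e.2 e.1 : edge (G e.1)), [ffun j => e.2 (lift e.1 j)] : {dffun forall j, vert (G (lift e.1 j))}).

Lemma ordS_neq n (x : 'I_n) : 1 < n -> ordS x != x.
Proof.
move=> n1; apply/eqP=> /(congr1 val) /=; have := ltn_ord x.
rewrite leq_eqVlt => /orP[/eqP En|lt]; last by rewrite modn_small //; lia.
by rewrite En modnn => x0; move: n1; rewrite -En -x0.
Qed.

Lemma ends_edge_of e : cart_ends (edge_of e) = [set tsrc e; ttgt e].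
Proof.
apply/setP=> v; rewrite !inE /=.
have agree (w : V) : (v == w) =
    (v e.1 == w e.1) && [forall j, v (lift e.1 j) == w (lift e.1 j)].
  apply/eqP/andP=> [->|[/eqP Ei /forallP Ej]].
    by split=> //; apply/forallP.
  apply/ffunP=> k; have [j ->|->//] := unliftP e.1 k.
  exact/eqP.
rewrite !agree /tsrc /ttgt !ffunE eqxx.
have E2 : [forall j, v (lift e.1 j) == ttgt e (lift e.1 j)] =
          [forall j, v (lift e.1 j) == e.2 (lift e.1 j)].
  apply: eq_forallb => j; rewrite ffunE.
  by rewrite [lift _ _ == _]eq_sym (negbTE (neq_lift _ _)).
rewrite /ttgt in E2; rewrite E2 -andb_orl; congr (_ && _).
by apply: eq_forallb => j; rewrite ffunE.
Qed.

Lemma edge_of_inj : injective edge_of.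
Proof.
move=> [i v] [i' v'] Ee.
have Ei : i = i' by have := congr1 (fun e : cart_edge G => tag e) Ee.
subst i'; congr pair; move/eqP: Ee; rewrite eq_Tagged /= => /eqP[Evi /ffunP Ev].
apply/ffunP=> k; have [j ->|->] := unliftP i k; last exact: Evi.
by have := Ev j; rewrite !ffunE.
Qed.

(** The vertices of the torus are counted by splitting off the coordinate of
    the direction of the edge. *)
Lemma card_cart_edge : #|cart_edge G| = d * #|{: V}|.
Proof.
rewrite card_tagged sumnE big_map big_enum /=.
rewrite (eq_bigr (fun=> #|{: V}|)); first by rewrite sum_nat_const card_ord.
move=> i _; rewrite card_prod !card_dffun_prod.
by rewrite [RHS](bigD1_ord i) // mulnC.
Qed.

Lemma comes_from_edge_of j e : comes_from j (edge_of e : edge (cart G)) = (e.1 == j).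
Proof.
apply/existsP/eqP => [[u /existsP[v]]|<-].
  rewrite !ends_edge_of !inE /tsrc /ttgt => /and3P[].
  case/orP=> /eqP-> /orP[]/eqP->; rewrite ?ffunE ?eqxx //; case: (j =P e.1) => // _; by rewrite ?eqxx.
exists (tsrc e); apply/existsP; exists (ttgt e).
by rewrite ends_edge_of !inE !eqxx orbT /tsrc /ttgt ffunE eqxx [_ == ordS _]eq_sym ordS_neq.
Qed.

Lemma ends_dart (e : bool * tedge) :
  cart_ends (edge_of e.2) = [set from tsrc ttgt e; into tsrc ttgt e].
Proof. by rewrite ends_edge_of /from /into; case: e.1; rewrite // setUC. Qed.

Lemma closed_walk_cycle (s : seq (bool * tedge)) u :
    walk tsrc ttgt u s u -> 1 < size s ->
    uniq [seq from tsrc ttgt e | e <- s] -> uniq [seq e.2 | e <- s] ->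
  exists H : subgraph (cart G),
    [/\ svert H = [set x in [seq from tsrc ttgt e | e <- s]],
        sedge H = [set edge_of e | e in [seq e.2 | e <- s]]
      & is_cycle (size s) H].
Proof.
move=> ws s_gt1 uniq_from uniq_edge; pose froms := [seq from tsrc ttgt e | e <- s]; rewrite -/froms in uniq_from *.
have u_from : u \in froms.
  by rewrite /froms; case: (s) ws s_gt1 => //= e s' /andP[/eqP<- _] _; rewrite mem_head.
have into_from e : e \in s -> into tsrc ttgt e \in froms.
  by move/(into_mem ws); rewrite inE => /orP[/eqP->|].
have closed (e : edge (cart G)) : e \in [set edge_of e | e in [seq e.2 | e <- s]] ->
    ends e \subset [set x in froms].
  case/imsetP=> _ /mapP[e' se' ->] ->; rewrite [ends _]ends_dart.
  by rewrite subUset !sub1set !inE into_from // map_f.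
exists (Subgraph closed); split=> //; split=> //.
have e0 : bool * tedge by case: (s) s_gt1.
have size_froms : size froms = size s by rewrite size_map.
exists (fun k : 'I_(size s) => nth u froms k).
exists (fun k : 'I_(size s) => edge_of (nth e0 s k).2 : edge (cart G)).
split=> /=.
- move=> k k' /eqP; rewrite nth_uniq ?size_froms // => /eqP; exact: val_inj.
- move=> k k' /edge_of_inj Ekk'; apply/val_inj/eqP.
  rewrite /= -(nth_uniq e0.2 _ _ uniq_edge) ?size_map //.
  by rewrite !(nth_map e0) // Ekk'.
- apply/setP=> x; rewrite inE; apply/idP/imsetP => [|[k _ ->]].
    by case/(nthP u) => k; rewrite size_froms => ltk <-; exists (Ordinal ltk).
  by rewrite mem_nth ?size_froms.
- apply/setP=> e; apply/imsetP/imsetP=> [[_ /mapP[e' + ->] ->]|[k _ ->]].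
    by case/(nthP e0) => k ltk <-; exists (Ordinal ltk).
  by exists (nth e0 s k).2 => //; apply: map_f; rewrite mem_nth.
move=> k; rewrite [LHS]ends_dart imsetU1 imset_set1.
have Ek : from tsrc ttgt (nth e0 s k) = nth u froms k by rewrite (nth_map e0).
congr [set _; _] => //; rewrite (from_nth _ ws) //=.
have := ltn_ord k; rewrite leq_eqVlt => /orP[/eqP Ek1|ltk1]; last by rewrite modn_small.
rewrite Ek1 modnn nth_default ?size_froms // (nth_map e0) ?(ltnW s_gt1) //.
by rewrite (walk_head _ ws) ?(ltnW s_gt1).
Qed.

(** The walks are only required to be disjoint: their total number of edges
    then forces them to cover the edges of the torus, hence its vertices. *)
Theorem decomposition_by_walks (I : finType) (w : I -> seq (bool * tedge)) L M :
    0 < d -> 1 < L -> #|I| * L = d * #|{: V}| ->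
    (forall h, exists u, walk tsrc ttgt u (w h) u) ->
    (forall h, size (w h) = L) ->
    (forall h, uniq [seq from tsrc ttgt e | e <- w h]) ->
    (forall h, uniq [seq e.2 | e <- w h]) ->
    (forall h h' e, e \in [seq e.2 | e <- w h] -> e \in [seq e.2 | e <- w h'] -> h = h') ->
    (forall h j, count (fun e => e.2.1 == j) (w h) = M) ->
  exists H : 'I_#|I| -> subgraph (cart G),
    decomposition H /\
    forall i, is_cycle L (H i) /\
      forall j : 'I_d, #|[set e in sedge (H i) | comes_from j e]| = M.
Proof.
move=> d0 L1 cardI closedw sizew uniqv uniqe disj countw.
have subg h : exists H : subgraph (cart G),
    [/\ svert H = [set x in [seq from tsrc ttgt e | e <- w h]],
        sedge H = [set edge_of e | e in [seq e.2 | e <- w h]]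
      & is_cycle L H].
  have [u wu] := closedw h.
  by have := closed_walk_cycle wu; rewrite sizew; apply.
have [H0 EH0] := fin_all_exists subg.
pose h_ (i : 'I_#|I|) : I := enum_val i.
pose H i := H0 (h_ i); have EH i := EH0 (h_ i).
exists H.
have disjH i j : i != j -> [disjoint sedge (H i) & sedge (H j)].
  move=> ne_ij; apply/pred0Pn=> -[e /= /andP[]].
  have [_ -> _] := EH i; have [_ -> _] := EH j.
  case/imsetP=> e1 we1 -> /imsetP[e2 we2 /edge_of_inj E12]; subst e2.
  by case/eqP: ne_ij; apply: enum_val_inj; apply: disj we1 we2.
have card_sedge i : #|sedge (H i)| = L.
  have [_ -> _] := EH i; rewrite card_imset; last exact: edge_of_inj.
  by rewrite (card_uniqP (uniqe _)) size_map sizew.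
have coverE : \bigcup_i sedge (H i) = [set: edge (cart G)].
  apply/eqP; rewrite eqEcard subsetT cardsT /= card_cart_edge -cardI.
  rewrite -[X in _ <= X]sum1_card partition_disjoint_bigcup // (eq_bigr (fun=> L)).
    by rewrite sum_nat_const card_ord.
  by move=> i _; rewrite sum1_card card_sedge.
split; last first.
  move=> i; have [_ Ei cycH] := EH i; split=> // j.
  rewrite -(countw (h_ i) j) Ei.
  pose es := [seq e.2 | e <- w (h_ i)].
  have -> : [set e in [set edge_of e | e in es] | comes_from j e] =
            [set edge_of e | e in [seq e <- es | e.1 == j]].
    apply/setP=> e; rewrite !inE; apply/andP/imsetP => [[/imsetP[e' se' ->]]|[e' + ->]].
      by rewrite comes_from_edge_of => Ej; exists e' => //; rewrite mem_filter Ej.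
    by rewrite mem_filter comes_from_edge_of => /andP[-> se']; split=> //; apply: imset_f.
  rewrite card_imset; last exact: edge_of_inj.
  by rewrite (card_uniqP (filter_uniq _ (uniqe _))) size_filter count_map.
split=> //; apply/setP=> v; rewrite inE; apply/bigcupP.
pose e : edge (cart G) := edge_of (Ordinal d0, v).
have : e \in \bigcup_i sedge (H i) by rewrite coverE inE.
case/bigcupP=> i _ ei; exists i => //.
suff /subsetP : ends e \subset svert (H i).
  by apply; rewrite [ends e]ends_edge_of !inE eqxx.
by case: (H i) ei => sv se /= closed /closed.
Qed.

End Torus.

(** * Stops: curves in mixed radix *)

Section Stops.
Variables (D : nat) (l a : nat -> nat).
Hypotheses (l_gt0 : forall j, j <= D -> 0 < l j)
  (l_even : forall j, j <= D -> 2 %| l j)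
  (a_gt0 : forall j, j < D -> 0 < a j) (a0 : a 0 = l 0)
  (a_cases : forall j, 0 < j < D -> a j = 1 \/ l j = 2 * a j).

(** The weight of the digit [j] in the system with radices [a 0], [a 1], and
    so on. *)
Definition period j := \prod_(i < j) a i.

(** The coordinate [j] at time [k] of the curve with offsets [o], not yet
    reduced modulo [l j].  The first digit is the coordinate itself. *)
Definition stop (o : nat -> nat) k j :=
  if j == 0 then k else o j + 2 * ((k %/ period j) %% a j) + odd k.

(** The sense of the step in direction [i] after time [k]: forwards at even
    times, backwards at odd ones, except that a carry into a digit with
    [l i = 2 a_i] adds 2 and so turns the backward step into a forward one. *)
Definition forward i k :=
  [|| i == 0, ~~ odd k | (l i == 2 * a i) && (period i %| k.+1)].

Lemma periodS j : period j.+1 = period j * a j.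
Proof. by rewrite /period big_ord_recr. Qed.

Lemma period_gt0 j : j <= D -> 0 < period j.
Proof.
elim: j => [|j IH] ltj; first by rewrite /period big_ord0.
by rewrite periodS muln_gt0 IH ?a_gt0 // ltnW.
Qed.

Lemma period_even j : 0 < j <= D -> 2 %| period j.
Proof.
case: j => // j; elim: j => [|j IH] ltj; rewrite periodS.
  by rewrite dvdn_mull // a0 l_even.
by apply: dvdn_mulr; apply: IH; apply: ltnW.
Qed.

Lemma odd_congr n k k' : 2 %| n -> k = k' %[mod n] -> odd k = odd k'.
Proof.
move=> n2 Ek; have : k %% 2 = k' %% 2 by rewrite -(modn_dvdm k n2) Ek modn_dvdm.
by rewrite !modn2 => /(congr1 odd); rewrite !oddb.
Qed.

Lemma congr_periodW j k k' : k = k' %[mod period j.+1] -> k = k' %[mod period j].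
Proof.
rewrite periodS => Ek.
by rewrite -(@modn_dvdm (period j * a j) k) ?dvdn_mulr // Ek modn_dvdm ?dvdn_mulr.
Qed.

Lemma stop_congr o j k k' : j < D -> k = k' %[mod period j.+1] ->
  stop o k j = stop o k' j %[mod l j].
Proof.
move=> ltj Ek; rewrite /stop; case: (j =P 0) => [j0|/eqP nj0].
  by move: Ek; rewrite j0 periodS /period big_ord0 mul1n a0.
rewrite -lt0n in nj0; have Ek' := congr_periodW Ek.
rewrite (odd_congr _ Ek') ?period_even ?nj0 ?(ltnW ltj) //.
by rewrite !modn_divl ![_ * period j]mulnC -periodS Ek.
Qed.

(** One digit of the decoding.  As [period j] is even, both times have the same
    parity, so the term [odd k] can be cancelled.  What remains determines the
    offset if [a j = 1], and both the offset, which is a bit, and the digit if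
    [l j = 2 a_j]. *)
Lemma stop_decode o o' j k k' : j < D ->
    o j < l j %/ a j -> o' j < l j %/ a j ->
    k = k' %[mod period j] -> stop o k j = stop o' k' j %[mod l j] ->
  k = k' %[mod period j.+1] /\ o j = o' j.
Proof.
move=> ltj lto lto' Ek; rewrite /stop periodS; case: (j =P 0) => [j0|/eqP nj0].
  move: lto lto'; rewrite j0 /period big_ord0 mul1n a0 divnn l_gt0 // !ltnS.
  by rewrite !leqn0 => /eqP-> /eqP->.
rewrite -lt0n in nj0; have j_int : 0 < j < D by rewrite nj0.
rewrite (odd_congr _ Ek) ?period_even ?nj0 ?(ltnW ltj) //.
move/eqP; rewrite eqn_modDr.
have a_j := a_gt0 ltj; have p_j := period_gt0 (ltnW ltj).
pose q := (k %/ period j) %% a j; pose q' := (k' %/ period j) %% a j.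
rewrite -/q -/q' => Eoq.
suff [Eq Eo] : q = q' /\ o j = o' j.
  split=> //; move: Eq; rewrite /q /q' !modn_divl => Eq.
  rewrite [_ * a j]mulnC (divn_eq (k %% _) (period j)) Eq.
  rewrite [RHS](divn_eq _ (period j)).
  by rewrite !modn_dvdm ?dvdn_mull // Ek.
have ltq : q < a j by rewrite ltn_mod.
have ltq' : q' < a j by rewrite ltn_mod.
clearbody q q'.
case: (a_cases j_int) => Ea.
  rewrite Ea divn1 in lto lto' ltq ltq' *.
  have q0 : q = 0 by lia. have q0' : q' = 0 by lia.
  by move: Eoq; rewrite q0 q0' !addn0 !modn_small // => /eqP.
rewrite Ea in lto lto' Eoq; rewrite mulnK // in lto lto'.
move: Eoq; rewrite !modn_small; [move/eqP| |]; clear -lto lto' ltq ltq'; lia.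
Qed.

Lemma forward_congr i k k' : i < D -> k = k' %[mod period i] -> forward i k = forward i k'.
Proof.
move=> lti Ek; rewrite /forward; case: (i =P 0) => //= /eqP; rewrite -lt0n => i0.
rewrite (odd_congr _ Ek) ?period_even ?i0 ?(ltnW lti) //.
have /eqP Ek1 : k.+1 == k'.+1 %[mod period i] by rewrite -addn1 -[k'.+1]addn1 eqn_modDr Ek.
by rewrite /dvdn Ek1.
Qed.

Lemma stop_step o i k : i < D ->
  if forward i k then stop o k.+1 i = (stop o k i).+1 %[mod l i]
  else (stop o k.+1 i).+1 = stop o k i %[mod l i].
Proof.
rewrite /forward /stop => lti; case: (i =P 0) => //= /eqP; rewrite -lt0n => i0.
have p2 : 2 %| period i by rewrite period_even ?i0 // ltnW.
have pk : k.+1 %/ period i = k %/ period i + (period i %| k.+1).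
  by rewrite divnS 1?addnC // period_gt0 // ltnW.
have [ok|ek] /= := boolP (odd k); last first.
  rewrite pk; have -> : period i %| k.+1 = false.
    by apply/negP => /(dvdn_trans p2); rewrite dvdn2 /= ek.
  by rewrite !addn0 addn1.
rewrite pk !addn0; have [dv|ndv] := boolP (period i %| k.+1); rewrite ?andbT ?andbF ?addn0 ?addn1 //.
case: (l i =P 2 * a i) => [El|nEl].
  have E x : o i + 2 * (x %% a i) = o i + 2 * x %[mod 2 * a i].
    by rewrite muln_modr modnDmr.
  rewrite El E -(addn2 (o i + _)) -[in RHS]modnDml E modnDml; congr (_ %% _); lia.
case: (a_cases (j := i)); rewrite ?i0 // => ->.
by rewrite !modn1 !muln0 !addn0.
Qed.

Lemma stop_parity o j k k' : j <= D -> stop o k j = stop o k' j %[mod l j] -> odd k = odd k'.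
Proof.
move=> lej /(odd_congr (l_even lej)); rewrite /stop; case: (j == 0) => //.
by rewrite !mul2n !oddD !odd_double !addbF !oddb => /addbI.
Qed.

(** The coordinates need not be taken at the same time: within a segment some
    have already moved, and for a backward step the base of the edge is at the
    later time.  The shift [delta] may depend on the digits already decoded. *)
Lemma stops_decode o o' k k' (delta : nat -> nat -> nat) :
    (forall j, j < D -> o j < l j %/ a j) -> (forall j, j < D -> o' j < l j %/ a j) ->
    (forall j h h', j < D -> h = h' %[mod period j] -> delta j h = delta j h') ->
    (forall j, j < D -> stop o (k + delta j k) j = stop o' (k' + delta j k') j %[mod l j]) ->
  k = k' %[mod period D] /\ forall j, j < D -> o j = o' j.
Proof.
move=> lto lto' delta_congr Estop.
suff IH n : n <= D -> k = k' %[mod period n] /\ forall j, j < n -> o j = o' j by apply: IH.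
elim: n => [|n IH] ltn; first by rewrite /period big_ord0 !modn1.
have [Ek Eo] := IH (ltnW ltn).
have Ed := delta_congr n k k' ltn Ek.
have Ekd : k + delta n k = k' + delta n k' %[mod period n].
  by apply/eqP; rewrite Ed eqn_modDr Ek.
have [/eqP + Eon] := stop_decode ltn (lto n ltn) (lto' n ltn) Ekd (Estop n ltn).
rewrite Ed eqn_modDr => /eqP Ek'; split=> // j; rewrite ltnS leq_eqVlt.
by case/orP=> [/eqP->|/Eo].
Qed.

End Stops.

(** * Lifting a grid decomposition to the torus *)

Lemma uniq_map_weaken (S T R : eqType) (f : S -> T) (g : S -> R) s :
    {in s &, forall x y, f x = f y -> g x = g y} ->
  uniq (map g s) -> uniq (map f s).
Proof.
elim: s => //= x s IH fg /andP[gx us]; rewrite IH ?andbT //; last first.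
  by move=> y y' sy sy'; apply: fg; rewrite inE ?sy ?sy' orbT.
apply: contra gx => /mapP[y sy fxy]; apply/mapP; exists y => //.
by apply: fg; rewrite ?mem_head // inE sy orbT.
Qed.

Lemma uniq_flatten_eq (T : eqType) (f : nat -> seq T) n t t' x :
    uniq (flatten [seq f t | t <- iota 0 n]) -> t < n -> t' < n ->
  x \in f t -> x \in f t' -> t = t'.
Proof.
wlog lt_tt' : t t' / t < t'.
  move=> H un ltt ltt' fx fx'; have [lt|lt|//] := ltngtP t t'; first exact: (H t t').
  by rewrite (H t' t).
elim: n => // n IH.
have -> : iota 0 n.+1 = iota 0 n ++ [:: n] by rewrite -addn1 iotaD.
rewrite map_cat flatten_cat /= cats0 cat_uniq => /and3P[un /hasPn dis _] _.
rewrite ltnS leq_eqVlt => /orP[/eqP Et'|ltt'] ft ft'; last first.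
  by apply: IH ft ft' => //; apply: ltn_trans ltt'.
case/negP: (dis x (eq_ind _ (fun n => x \in f n) ft' _ Et')).
by apply: mem_blocks ft; rewrite -Et'.
Qed.

Section Lift.
Variables (D : nat) (len : 'I_D.+1 -> nat) (sigma : {perm 'I_D.+1}) (a : nat -> nat).
Hypothesis len_gt1 : forall i, 1 < len i.
Hypothesis len_even : forall i, 2 %| len i.
Hypothesis D_gt0 : 0 < D.

(** Position in the order of the digits, as opposed to the index in the product;
    the last position [D] is that of the direction with the grid cycles. *)
Definition dir j : 'I_D.+1 := sigma (inord j).
Definition rank (i : 'I_D.+1) : nat := (sigma^-1)%g i.
Definition side j := len (dir j).

Lemma rank_dir j : j <= D -> rank (dir j) = j.
Proof. by move=> lej; rewrite /rank /dir permK inordK. Qed.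

Lemma dir_rank i : dir (rank i) = i.
Proof. by rewrite /rank /dir inord_val permKV. Qed.

Lemma rank_le i : rank i <= D. Proof. by rewrite -ltnS ltn_ord. Qed.

Hypotheses (a_gt0 : forall j, j < D -> 0 < a j) (a0 : a 0 = side 0)
  (a_cases : forall j, 0 < j < D -> a j = 1 \/ side j = 2 * a j).

Let side_gt0 j : j <= D -> 0 < side j. Proof. by move=> _; apply: ltnW (len_gt1 _). Qed.
Let side_even j : j <= D -> 2 %| side j. Proof. by move=> _; apply: len_even. Qed.

Local Notation V := (cart_vert (fun i => cyc (len i))).
Local Notation stop := (stop a).
Local Notation forward := (forward side a).
Local Notation tv := (torus_vertex len_gt1).

Definition coords o k (delta : nat -> nat) y (i : 'I_D.+1) :=
  if rank i == D then y else stop o (k + delta (rank i)) (rank i).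

(** The point of the segment starting at time [v.1] where the first [i]
    directions have been moved; [v.2] is the coordinate in the last direction. *)
Definition node o i (v : nat * nat) : V := tv (coords o v.1 (fun j => j < i : nat) v.2).

(** The base of the edge from [node o i v] to [node o i.+1 v], which is the
    second of them if the step goes backwards. *)
Definition base o i (v : nat * nat) : V :=
  tv (coords o v.1 (fun j => (j < i) + ((j == i) && ~~ forward i v.1)) v.2).

Definition segment o (e : gedge) : seq (bool * tedge len) :=
  if e.1 then [:: (true, (dir D, node o 0 e.2))]
  else [seq (forward i e.2.1, (dir i, base o i e.2)) | i <- iota 0 D].

Lemma torus_vertex_coords o k delta y o' k' delta' y' :
  tv (coords o k delta y) = tv (coords o' k' delta' y') <->
  (forall j, j < D -> stop o (k + delta j) j = stop o' (k' + delta' j) j %[mod side j])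
  /\ y = y' %[mod side D].
Proof.
rewrite torus_vertexP; split=> [E|[E Ey] i].
  split=> [j ltj|].
    have := E (dir j); rewrite /coords rank_dir ?(ltnW ltj) //.
    by rewrite ltn_eqF.
  by have := E (dir D); rewrite /coords rank_dir // eqxx.
rewrite /coords; case: (rank i =P D) => [Ei|/eqP Ei].
  by rewrite -(dir_rank i) Ei.
rewrite -(dir_rank i) rank_dir ?rank_le //; apply: E.
by rewrite ltn_neqAle Ei rank_le.
Qed.

Lemma ttgt_torus_vertex i x :
  ttgt (i, tv x) = tv (fun k => if k == i then (x k).+1 else x k).
Proof.
apply/ffunP=> k; rewrite /ttgt !ffunE /=; apply: val_inj.
case: (k =P i) => [->|] /=; rewrite ?eqxx //.
by rewrite -addn1 modnDml addn1.
Qed.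

Lemma segment_step o i v : i < D ->
  walk (@tsrc _ len) (@ttgt _ len) (node o i v)
    [:: (forward i v.1, (dir i, base o i v))] (node o i.+1 v).
Proof.
move=> lti.
have Ebase : base o i v = if forward i v.1 then node o i v else node o i.+1 v.
  rewrite /base /node; case: (forward i v.1); apply/torus_vertex_coords; split=> // j ltj.
    by rewrite andbF addn0.
  by rewrite andbT ltnS [in RHS]leq_eqVlt; case: (j =P i) => [->|_]; rewrite ?ltnn //= addn0.
have Etgt : ttgt (dir i, base o i v) = if forward i v.1 then node o i.+1 v else node o i v.
  have := stop_step side_even a_gt0 a0 a_cases o v.1 lti.
  rewrite Ebase; case: (forward i v.1) => Estep; rewrite ttgt_torus_vertex;
    apply/torus_vertexP => k; rewrite /coords;
    (case: (k =P dir i) => [->|ne_k];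
      [rewrite rank_dir ?(ltnW lti) // (ltn_eqF lti) ltnS ?leqnn ltnn addn0 addn1 // |]).
  - case: (rank k =P D) => // _; rewrite ltnS [in RHS]leq_eqVlt.
    by case: (rank k =P i) => // Ek; case: ne_k; rewrite -Ek dir_rank.
  case: (rank k =P D) => // _; rewrite ltnS [in LHS]leq_eqVlt.
  by case: (rank k =P i) => // Ek; case: ne_k; rewrite -Ek dir_rank.
rewrite /= /from /into /= /tsrc Etgt Ebase /=.
by case: (forward i v.1); rewrite !eqxx.
Qed.

Lemma node_last o x y : node o D (x, y) = node o 0 (x.+1, y).
Proof.
apply/torus_vertex_coords; split=> // j ltj /=.
by rewrite ltj addn1 addn0.
Qed.

Lemma walk_segment o e :
  walk (@tsrc _ len) (@ttgt _ len) (node o 0 (gsrc e)) (segment o e) (node o 0 (gtgt e)).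
Proof.
case: e => [[] [x y]]; rewrite /segment /gsrc /gtgt /=.
  rewrite /from /into /= /tsrc eqxx /= ttgt_torus_vertex; apply/eqP/torus_vertexP => k.
  rewrite /coords; case: (k =P dir D) => [->|ne_k]; first by rewrite rank_dir // eqxx.
  by case: (rank k =P D) => // Ek; case: ne_k; rewrite -[LHS]dir_rank; congr dir.
rewrite -node_last.
suff IH n : n <= D -> walk (@tsrc _ len) (@ttgt _ len) (node o 0 (x, y))
    [seq (forward i x, (dir i, base o i (x, y))) | i <- iota 0 n] (node o n (x, y)).
  exact: IH.
elim: n => [|n IH] ltn; first exact: eqxx.
have -> : iota 0 n.+1 = iota 0 n ++ [:: n] by rewrite -addn1 iotaD.
rewrite map_cat; apply: walk_cat (IH (ltnW ltn)) _; exact: (segment_step o (x, y)).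
Qed.

Definition offset (o : nat -> nat) := forall j, j < D -> o j < side j %/ a j.

Local Notation N := (period a D).
Local Notation z := (side D).
Local Notation md := (modv N z).

Lemma node_congr o v v' : md v = md v' -> node o 0 v = node o 0 v'.
Proof.
case=> Ex Ey; apply/torus_vertex_coords; split=> // j ltj; rewrite !addn0.
apply: (stop_congr side_even a0) => //.
have dvN i : j.+1 + i <= D -> period a j.+1 %| period a (j.+1 + i).
  elim: i => [|i IH] lei; first by rewrite addn0.
  by rewrite addnS (periodS a (j.+1 + i)) dvdn_mulr // IH // ltnW // -addnS.
have {}dvN : period a j.+1 %| N by have := dvN (D - j.+1); rewrite subnKC //; apply.
by rewrite -(modn_dvdm v.1 dvN) Ex modn_dvdm.
Qed.

(** If [i < i'], the coordinate [i] has moved in the second point only, while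
    the coordinate [i'] has moved in neither; as the parity of a coordinate is
    that of the time, the two times would differ and agree modulo 2. *)
Lemma node_inj o i i' v v' : offset o -> i < D -> i' < D ->
  node o i v = node o i' v' -> i = i' /\ md v = md v'.
Proof.
wlog lt_ii' : i i' v v' / i <= i'.
  move=> H oo lti lti' Ev; case/orP: (leq_total i i') => le; first exact: H.
  by have [-> ->] := H _ _ _ _ le oo lti' lti (esym Ev).
move=> oo lti lti' /torus_vertex_coords[Ex Ey]; move: lt_ii'.
rewrite leq_eqVlt => /orP[/eqP Ei|lt_ii'].
  split=> //; rewrite -Ei in Ex; rewrite /modv Ey; congr pair.
  by have [] := stops_decode side_gt0 side_even a_gt0 a0 a_cases
                  (delta := fun j _ => j < i : nat) oo oo (fun _ _ _ _ _ => erefl) Ex.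
have := Ex i lti; have := Ex i' lti'.
rewrite !ltnn ltnNge (ltnW lt_ii') lt_ii' !addn0 addn1.
move/(stop_parity side_even (ltnW lti')) => odd_i' /(stop_parity side_even (ltnW lti)).
by rewrite /= odd_i'; case: (odd _).
Qed.

(** All the edges of the torus, named by a direction and a vertex of the grid. *)
Definition edge_at o j v : tedge len := (dir j, if j == D then node o 0 v else base o j v).

Lemma edge_at_inj o o' j j' v v' : offset o -> offset o' -> j <= D -> j' <= D ->
  edge_at o j v = edge_at o' j' v' ->
  [/\ j = j', forall i, i < D -> o i = o' i & md v = md v'].
Proof.
move=> oo oo' lej lej' [Ed]; have {Ed} Ej : j = j' by rewrite -(rank_dir lej) Ed rank_dir.
have decode := stops_decode side_gt0 side_even a_gt0 a0 a_cases oo oo'.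
rewrite -{}Ej; case: (j == D) => /torus_vertex_coords[Ex Ey].
  have [] := decode _ _ (fun _ _ => 0) (fun _ _ _ _ _ => erefl) Ex.
  by move=> Ev1 Eo; split=> //; congr pair.
have [|Ev1 Eo] := decode _ _ (fun i h => (i < j) + ((i == j) && ~~ forward j h)) _ Ex.
  move=> i h h' lti Eh; case: (i =P j) => //= Eij.
  by rewrite (forward_congr side_even a0 (k := h) (k' := h')) // -Eij.
by split=> //; congr pair.
Qed.

Variables (aq : nat) (W : nat -> seq gdart).
Hypothesis fairW : fair_grid N z aq W.

Definition lift_walk o t := flatten (map (subst (segment o)) (W t)).

Lemma lift_closed o t : t < z %/ aq ->
  exists u, walk (@tsrc _ len) (@ttgt _ len) u (lift_walk o t) u.
Proof.
have [closedW _ _ _] := fairW => /closedW[u [v [wW Euv]]].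
exists (node o 0 u); rewrite {2}(node_congr o Euv).
by apply: walk_subst wW => d _; apply: walk_segment.
Qed.

Lemma perm_subst_edges o (d : gdart) :
  perm_eq [seq e.2 | e <- subst (segment o) d] [seq e.2 | e <- segment o d.2].
Proof.
by rewrite /subst; case: d.1 => //; rewrite map_rev perm_rev -map_comp.
Qed.

Definition dirs (e : gedge) := if e.1 then [:: D] else iota 0 D.

Lemma segment_edges o e :
  [seq e.2 | e <- segment o e] = [seq edge_at o j e.2 | j <- dirs e].
Proof.
rewrite /segment /dirs; case: e => [[] v] /=; first by rewrite /edge_at eqxx.
rewrite -map_comp; apply/eq_in_map => j; rewrite mem_iota /= => ltj.
by rewrite /edge_at ltn_eqF.
Qed.

Lemma perm_lift_edges o t :
  perm_eq [seq e.2 | e <- lift_walk o t]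
     [seq edge_at o p.1 p.2 | p <- [seq (j, e.2) | e <- [seq d.2 | d <- W t], j <- dirs e]].
Proof.
rewrite /lift_walk; elim: (W t) => //= d s IH; rewrite !map_cat perm_cat //.
by apply: perm_trans (perm_subst_edges o d) _; rewrite segment_edges -map_comp.
Qed.

Lemma mem_dirs e j : j \in dirs e -> j <= D /\ (j == D) = e.1.
Proof.
rewrite /dirs; case: e.1; first by rewrite inE => /eqP->; rewrite eqxx.
by rewrite mem_iota => /andP[_ ltj]; rewrite ltnW // ltn_eqF.
Qed.

Lemma mem_lift_edges o t e : e \in [seq e.2 | e <- lift_walk o t] ->
  exists j g, [/\ j <= D, e = edge_at o j g.2, g.1 = (j == D) & g \in [seq d.2 | d <- W t]].
Proof.
rewrite (perm_mem (perm_lift_edges o t)) => /mapP[_ /allpairsPdep[g [j [Wg gj ->]]] ->].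
by have [lej Ej] := mem_dirs gj; exists j, g.
Qed.

Lemma lift_disjoint o o' t t' e : offset o -> offset o' -> t < z %/ aq -> t' < z %/ aq ->
    e \in [seq e.2 | e <- lift_walk o t] -> e \in [seq e.2 | e <- lift_walk o' t'] ->
  t = t' /\ forall j, j < D -> o j = o' j.
Proof.
move=> oo oo' ltt ltt' /mem_lift_edges[j [g [lej -> gj Wg]]].
move=> /mem_lift_edges[j' [g' [lej' Ee gj' Wg']]].
have [Ej Eo Eg] := edge_at_inj oo oo' lej lej' Ee; split=> //.
have [_ _ _ uniqW] := fairW.
have Emode : mode N z g = mode N z g' by rewrite /mode gj gj' Ej Eg.
apply: (uniq_flatten_eq uniqW ltt ltt' (x := mode N z g)).
  by rewrite map_comp map_f.
by rewrite Emode map_comp map_f.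
Qed.

Lemma uniq_modes t : t < z %/ aq -> uniq [seq mode N z e | e <- [seq d.2 | d <- W t]].
Proof.
have [_ _ _ +] := fairW; move=> + ltt; elim: (z %/ aq) ltt => // n IH.
have -> : iota 0 n.+1 = iota 0 n ++ [:: n] by rewrite -addn1 iotaD.
rewrite map_cat flatten_cat /= cats0 cat_uniq ltnS leq_eqVlt.
by move=> /orP[/eqP->|/IH{}IH] /and3P[/IH // ? _ ?]; rewrite -map_comp.
Qed.

Lemma uniq_lift_edges o t : offset o -> t < z %/ aq -> uniq [seq e.2 | e <- lift_walk o t].
Proof.
move=> oo ltt; rewrite (perm_uniq (perm_lift_edges o t)).
apply: (uniq_map_weaken (g := fun p => (p.1, md p.2))).
  move=> _ _ /allpairsPdep[g [j [_ gj ->]]] /allpairsPdep[g' [j' [_ gj' ->]]] /=.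
  have [lej _] := mem_dirs gj; have [lej' _] := mem_dirs gj'.
  by case/(edge_at_inj oo oo lej lej') => -> _ ->.
pose es := [seq mode N z e | e <- [seq d.2 | d <- W t]].
have -> : [seq (p.1, md p.2) | p <- [seq (j, e.2) | e <- [seq d.2 | d <- W t], j <- dirs e]]
    = [seq (j, e.2) | e <- es, j <- dirs e].
  by rewrite /es map_allpairs !allpairs_mapl.
apply: allpairs_uniq_dep; first exact: uniq_modes.
  by move=> e _; rewrite /dirs; case: e.1; rewrite ?iota_uniq.
move=> _ _ /allpairsPdep[[b v] [j [_ gj ->]]] /allpairsPdep[[b' v'] [j' [_ gj' ->]]] /=.
case=> Ej ->; have [_ /= Eb] := mem_dirs gj; have [_ /= Eb'] := mem_dirs gj'.
by rewrite -Eb -Eb' Ej.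
Qed.

(** A lifted dart starts at the image of the start of the original one and, if
    it is horizontal, runs through the interior points of the segment of its
    edge, in one or the other sense. *)
Lemma perm_subst_sources o (d : gdart) :
  perm_eq [seq from (@tsrc _ len) (@ttgt _ len) e | e <- subst (segment o) d]
    [seq node o p.1 p.2
       | p <- (0, gfrom d) :: [seq (i, d.2.2) | i <- if d.2.1 then [::] else iota 1 D.-1]].
Proof.
case: d => [b [[] v]]; first by
  have /= /andP[/eqP Ef /eqP Ei] := walk_segment o (true, v); case: b;
  rewrite /subst /segment /from /into /= in Ef Ei *; rewrite ?Ef ?Ei perm_refl.
have steps i : i \in iota 0 D ->
   from (@tsrc _ len) (@ttgt _ len) (forward i v.1, (dir i, base o i v)) = node o i v /\
   into (@tsrc _ len) (@ttgt _ len) (forward i v.1, (dir i, base o i v)) = node o i.+1 v.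
  rewrite mem_iota /= => lti; have /= /andP[/eqP-> /eqP->] := segment_step o v lti.
  by [].
have iotaE : iota 0 D = 0 :: iota 1 D.-1 by case: (D) D_gt0.
rewrite /subst /segment /=; case: b; rewrite /gsrc /gtgt.
  rewrite -map_comp -[X in perm_eq _ (_ :: X)]map_comp.
  have -> : node o 0 v :: [seq node o i v | i <- iota 1 D.-1] = [seq node o i v | i <- iota 0 D].
    by rewrite iotaE.
  rewrite (eq_in_map _ (fun i => node o i v) _).1 ?perm_refl // => i; by case/steps.
rewrite map_rev perm_rev -2!map_comp -[X in perm_eq _ (_ :: X)]map_comp.
have -> : node o 0 (gtgt (false, v)) = node o D v by case: v {steps} => x y; rewrite node_last.
rewrite (eq_in_map _ (fun i => node o i.+1 v) _).1; last first.
  by move=> i /steps[_ <-]; rewrite /= /from /into /=; case: (forward _ _).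
have -> : [seq node o i.+1 v | i <- iota 0 D] = [seq node o i v | i <- iota 1 D.-1 ++ [:: D]].
  have -> : iota 1 D.-1 ++ [:: D] = [seq i.+1 | i <- iota 0 D].
    rewrite -[[:: D]]/(iota D 1) -{2}(prednK D_gt0) -[D.-1.+1]add1n -iotaD addn1 prednK //.
    by rewrite -[1]addn0 iotaDl.
  by rewrite -map_comp.
by rewrite map_cat perm_catC perm_refl.
Qed.

(** Two visits of the same point either come from two visits of a grid vertex,
    or, for an interior point of a segment, from two visits of a grid edge. *)
Lemma uniq_lift_sources o t : offset o -> t < z %/ aq ->
  uniq [seq from (@tsrc _ len) (@ttgt _ len) e | e <- lift_walk o t].
Proof.
move=> oo ltt.
pose inner (e : gedge) := if e.1 then [::] else iota 1 D.-1.
pose keys := [seq (0, gfrom d) | d <- W t] ++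
   [seq (i, e.2) | e <- [seq d.2 | d <- W t], i <- inner e].
have perm_keys : perm_eq [seq from (@tsrc _ len) (@ttgt _ len) e | e <- lift_walk o t]
    [seq node o p.1 p.2 | p <- keys].
  rewrite /keys /lift_walk; elim: (W t) => //= d s IH.
  rewrite map_cat; apply: perm_trans (perm_cat (perm_subst_sources o d) IH) _.
  rewrite -map_cat /= perm_cons; apply: perm_map.
  have -> : [seq (i, d.2.2) | i <- inner d.2] ++ [seq (i, e.2) | e <- [seq d.2 | d <- s], i <- inner e] =
            [seq (i, e.2) | e <- [seq d.2 | d <- d :: s], i <- inner e] by [].
  exact: permEl (perm_catCA _ _ _).
rewrite (perm_uniq perm_keys).
have lt_key p : p \in keys -> p.1 < D.
  rewrite mem_cat => /orP[/mapP[? _ ->] //|/allpairsPdep[e [i [_ + ->]]] /=].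
  by rewrite /inner; case: e.1 => //; rewrite mem_iota; lia.
apply: (uniq_map_weaken (g := fun p => (p.1, md p.2))).
  by move=> p p' /lt_key ltp /lt_key ltp' /(node_inj oo ltp ltp')[-> ->].
rewrite map_cat cat_uniq; apply/and3P; split.
- have [_ /(_ t ltt) uniqW _ _] := fairW.
  rewrite -map_comp (map_comp (pair 0) (fun d => md (gfrom d))) map_inj_uniq //.
  by move=> ? ? [].
- apply/hasPn => _ /mapP[_ /allpairsPdep[e [i [_ + ->]]] ->] /=.
  rewrite /inner; case: e.1 => //; rewrite mem_iota => /andP[i0 _].
  by apply/mapP => -[_ /mapP[d _ ->] [Ei]]; rewrite Ei in i0.
pose es := [seq mode N z e | e <- [seq d.2 | d <- W t]].
have -> : [seq (p.1, md p.2) | p <- [seq (i, e.2) | e <- [seq d.2 | d <- W t], i <- inner e]]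
    = [seq (j, e.2) | e <- es, j <- inner e].
  by rewrite /es map_allpairs !allpairs_mapl.
apply: allpairs_uniq_dep; first exact: uniq_modes.
  by move=> e _; rewrite /inner; case: e.1; rewrite ?iota_uniq.
move=> _ _ /allpairsPdep[[b v] [j [_ gj ->]]] /allpairsPdep[[b' v'] [j' [_ gj' ->]]] /=.
by case=> -> ->; move: gj gj'; rewrite /inner /=; case: b; case: b'.
Qed.

Lemma size_lift o t : t < z %/ aq -> size (lift_walk o t) = D.+1 * (N * aq).
Proof.
have [_ _ countW _] := fairW => ltt.
suff -> : size (lift_walk o t) = count (fun d : gdart => d.2.1 == true) (W t)
    + D * count (fun d : gdart => d.2.1 == false) (W t) by rewrite !countW // mulSn.
rewrite /lift_walk; elim: (W t) => [|d s IH] /=; first by rewrite muln0.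
rewrite size_cat {}IH /subst /segment; case: d => [b [[] v]] /=; case: b => //=;
  by rewrite ?size_rev !size_map ?size_iota; clear; lia.
Qed.

Lemma count_lift o t i : t < z %/ aq ->
  count (fun e : bool * tedge len => e.2.1 == i) (lift_walk o t) = N * aq.
Proof.
have [_ _ countW _] := fairW => ltt; rewrite -(countW t (rank i == D) ltt).
rewrite -(count_map snd (fun e : tedge len => e.1 == i)).
rewrite (seq.permP (perm_lift_edges o t)) count_map.
elim: (W t) => //= d s IH; rewrite count_cat {}IH; congr (_ + _).
rewrite count_map /= (eq_in_count (a2 := pred1 (rank i))); last first.
  move=> j /mem_dirs[lej _] /=; apply/eqP/eqP => [<-|->]; first by rewrite rank_dir.
  exact: dir_rank.
rewrite count_uniq_mem /dirs; last by case: d.2.1; rewrite ?iota_uniq.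
congr nat_of_bool; case: d.2.1; first by rewrite inE; case: (rank i == D).
rewrite mem_iota /= add0n ltn_neqAle rank_le andbT.
by case: (rank i == D).
Qed.

End Lift.

(** * Fair decompositions of a torus *)

Lemma fair_grid_exists N z a : 0 < N -> 4 %| N -> 0 < z -> 0 < a -> 2 * a %| z ->
  a = 1 \/ ~~ odd a -> exists W, fair_grid N z a W.
Proof.
move=> N0 N4 z0 a0 az [a1|ea].
  rewrite a1 in az *; exists (zigzag N); apply: zigzag_fair => //.
  exact: dvdn_trans N4.
have [m Em] : exists m, a = (2 * m).+2 by exists (a./2).-1; lia.
by rewrite Em in az *; exists (band N m); apply: band_fair.
Qed.

Section FairTorus.
Variables (D : nat) (len al : 'I_D.+1 -> nat) (p q : 'I_D.+1).
Hypotheses (neq_pq : p != q) (len_gt0 : forall i, 0 < len i)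
  (len_even : forall i, 2 %| len i) (al_gt0 : forall i, 0 < al i)
  (al_p : al p = len p) (p4 : 4 %| len p)
  (al_q : 2 * al q %| len q) (al_q_even : al q = 1 \/ ~~ odd (al q))
  (al_cases : forall i, i != p -> i != q -> al i = 1 \/ len i = 2 * al i).

Let len_gt1 i : 1 < len i.
Proof. by have := dvdn_leq (len_gt0 i) (len_even i). Qed.

Let D_gt0 : 0 < D.
Proof.
rewrite lt0n; apply: contra neq_pq => /eqP D0.
by apply/eqP/val_inj => /=; have := leq_ord p; have := leq_ord q; lia.
Qed.

Let al_dvd i : al i %| len i.
Proof.
have [->|np] := eqVneq i p; first by rewrite al_p.
have [->|nq] := eqVneq i q; first by apply: dvdn_trans al_q; rewrite dvdn_mull.
by have [->|->] := al_cases np nq; rewrite ?dvd1n ?dvdn_mull.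
Qed.

Definition sort_dirs : {perm 'I_D.+1} :=
  (tperm ord_max (tperm ord0 p q) * tperm ord0 p)%g.

Lemma dir_first : dir sort_dirs 0 = p.
Proof.
rewrite /dir /sort_dirs permM.
have -> : inord 0 = ord0 :> 'I_D.+1 by apply: val_inj; rewrite /= inordK.
suff -> : tperm ord_max (tperm ord0 p q) ord0 = ord0 by rewrite tpermL.
apply: tpermD; first by apply/eqP => /(congr1 val) /= E; move: D_gt0; rewrite lt0n E.
by apply: contra neq_pq => /eqP E; rewrite -[q](tpermK ord0 p) E tpermL.
Qed.

Lemma dir_last : dir sort_dirs D = q.
Proof.
rewrite /dir /sort_dirs permM.
have -> : inord D = ord_max :> 'I_D.+1 by apply: val_inj; rewrite /= inordK.
by rewrite tpermL tpermK.
Qed.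

Let a j := al (dir sort_dirs j).
Local Notation sorted_side := (side len sort_dirs).

Lemma prod_dir (F : 'I_D.+1 -> nat) :
  \prod_(j < D) F (dir sort_dirs j) * F q = \prod_i F i.
Proof.
rewrite -{1}dir_last -(big_ord_recr D (fun j => F (dir sort_dirs j))).
rewrite [RHS](reindex_inj (perm_inj (s := sort_dirs))); apply: eq_bigr => i _.
by rewrite /dir inord_val.
Qed.

Let a_gt0 j : j < D -> 0 < a j. Proof. by move=> _; apply: al_gt0. Qed.
Let a0 : a 0 = sorted_side 0. Proof. by rewrite /a /side dir_first. Qed.
Let a_cases j : 0 < j < D -> a j = 1 \/ sorted_side j = 2 * a j.
Proof.
case/andP=> j0 ltj; apply: al_cases.
  rewrite -dir_first; apply/eqP => /(congr1 (rank sort_dirs)).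
  by rewrite !rank_dir ?(ltnW ltj) // => Ej; rewrite Ej in j0.
rewrite -dir_last; apply/eqP => /(congr1 (rank sort_dirs)).
by rewrite !rank_dir ?(ltnW ltj) // => Ej; rewrite Ej ltnn in ltj.
Qed.

Definition offsets : finType := {dffun forall i : 'I_D, 'I_(sorted_side i %/ a i)}.

Definition offset_of (f : offsets) j : nat :=
  if insub j is Some i then f i : nat else 0.

Lemma offset_ofE (f : offsets) j (ltj : j < D) : offset_of f j = f (Ordinal ltj).
Proof. by rewrite /offset_of insubT. Qed.

(** The cycles are named by the offsets in the directions other than [p] and
    [q] and by the number of a grid cycle.  The grid has [period a D] columns,
    a multiple of [len p] and therefore of 4. *)
Theorem fair_torus_decomposition :
  exists H : 'I_(\prod_i (len i %/ al i)) -> subgraph (cart (fun i => cyc (len i))),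
    decomposition H /\
    forall i, is_cycle (D.+1 * \prod_i al i) (H i) /\
      forall j : 'I_D.+1, #|[set e in sedge (H i) | comes_from j e]| = \prod_i al i.
Proof.
have N0 : 0 < period a D by apply: (period_gt0 a_gt0).
have EN : period a D * al q = \prod_i al i by rewrite -(prod_dir al).
have N4 : 4 %| period a D.
  rewrite /period; case: (D) D_gt0 => // D' _; rewrite big_ord_recl dvdn_mulr //.
  by rewrite /= a0 /side dir_first.
have Eside : sorted_side D = len q by rewrite /side dir_last.
have [W fairW] : exists W, fair_grid (period a D) (sorted_side D) (al q) W.
  by apply: fair_grid_exists; rewrite ?Eside.
pose I : finType := (offsets * 'I_(sorted_side D %/ al q))%type.
have cardI : #|I| = \prod_i (len i %/ al i).
  rewrite card_prod card_ord card_dffun_prod -(prod_dir (fun i => len i %/ al i)) Eside.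
  by congr (_ * _); apply: eq_bigr => i _; rewrite card_ord.
rewrite -cardI.
pose w (h : I) := lift_walk sort_dirs a len_gt1 W (offset_of h.1) h.2.
have off (f : offsets) : offset len sort_dirs a (offset_of f).
  by move=> j ltj; rewrite (offset_ofE f ltj).
have P0 : 0 < \prod_i al i by rewrite prodn_gt0.
apply: (decomposition_by_walks len_gt1 (w := w)) => //.
- by rewrite -EN in P0 *; clear -P0 D_gt0; nia.
- rewrite cardI card_dffun_prod mulnCA -big_split /=; congr (_ * _).
  by apply: eq_bigr => i _; rewrite card_ord divnK.
- by move=> h; apply: (lift_closed len_gt1 len_even a_gt0 a0 a_cases fairW).
- by move=> h; rewrite (size_lift len_gt1 fairW) // EN.
- by move=> h; apply: (uniq_lift_sources len_gt1 len_even D_gt0 a_gt0 a0 a_cases fairW).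
- by move=> h; apply: (uniq_lift_edges len_gt1 len_even a_gt0 a0 a_cases fairW).
- move=> [f t] [f' t'] e /= ef ef'.
  have [Et Ef] := lift_disjoint len_even a_gt0 a0 a_cases fairW (off f) (off f')
     (ltn_ord t) (ltn_ord t') ef ef'.
  congr pair; last exact: val_inj.
  apply/ffunP=> i; apply: val_inj; have := Ef i (ltn_ord i).
  rewrite !(offset_ofE _ (ltn_ord i)).
  by have -> : Ordinal (ltn_ord i) = i by apply: val_inj.
by move=> h j; rewrite (count_lift len_gt1 fairW).
Qed.

End FairTorus.

(** * The coefficients and the decomposition of the torus *)

Section Coefficients.
Variables (d : nat) (z b : nat -> nat).
Hypothesis z_gt0 : forall j, 1 <= j <= d -> 0 < z j /\ ~~ odd (z j).

Lemma half_prod_gt0 k : k <= d.+1 -> 0 < half_prod z k.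
Proof.
move=> lek; rewrite /half_prod big_mkord prodn_gt0 // => i.
have [|z0 ez] := z_gt0 (j := i.+1); first by have := ltn_ord i; lia.
by rewrite divn_gt0 //; lia.
Qed.

Lemma eta_alphaE k : 0 < k <= d -> eta_alpha d z b k = (0 < bx d b k).
Proof.
move=> /andP[k0 led].
rewrite /eta_alpha /eta /alpha.
have [zd _] := z_gt0 (j := d) (introT andP (conj (leq_trans k0 led) (leqnn d))).
rewrite -mulnA ltn_pmul2l // -[X in X < _]mul1n ltn_pmul2r ?half_prod_gt0 //; last exact: leqW.
by rewrite addn1 ltnS; case: (0 < bx d b k).
Qed.

(** Here [A_2 = 1] means [z_1 / 2 <= b_1 + 1], so that [z_1 = 2 (b_1 + 1)] and
    both alternatives of [A_3] agree. *)
Lemma coefA3E : 2 <= d -> b 1 <= z 1 %/ 2 - 1 -> coefA d z b 3 = 2 * (b 1 + 1).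
Proof.
move=> d2 b1; have [|z1 ez1] := z_gt0 (j := 1); first by lia.
have [|zd ezd] := z_gt0 (j := d); first by lia.
rewrite /coefA /= /coefA3 /coefA2 /eta /bx /alpha /half_prod /= big_nat1 d2.
rewrite [_ * _ + 1]addn1 ltnS leq_pmul2l //.
by case: leqP => le /=; rewrite ?expn0 ?expn1 ?mul1n ?muln1; lia.
Qed.

(** If [b_(j+1) > 0] the coefficient is [z_j / 2], and [b_j] is full; otherwise
    it is [b_j + 1] or, if [b_j = 0], an empty power. *)
Lemma coefAE j : 2 <= j < d -> (0 < bx d b j.+1 -> b j = z j %/ 2 - 1) ->
  coefA d z b (j + 2) = b j + 1.
Proof.
case/andP=> j2 ltj full; have [|zj ezj] := z_gt0 (j := j); first by lia.
rewrite /coefA; have -> : (j + 2 == 3) = false by apply/eqP; lia.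
have -> : j + 2 - 1 = j.+1 by lia.
rewrite addnK !eta_alphaE ?(ltnW ltj) ?(ltnW j2) //.
have -> : bx d b j = b j by rewrite /bx ltj.
case: (0 < bx d b j.+1) full => [/(_ isT) -> | _] /=.
  by rewrite mul0n expn0 expn1 mul1n; lia.
rewrite expn0 muln1 subn0 mul1n; case: (posnP (b j)) => [->|_]; first by rewrite exp1n.
by rewrite expn1.
Qed.

End Coefficients.

Theorem theorem5 (d : nat) (z b : nat -> nat)
  (hd : 2 <= d)
  (hz : forall j, 1 <= j <= d -> 0 < z j /\ ~~ odd (z j))
  (hb : forall j, 1 <= j <= d - 1 -> odd (b j) \/ b j = 0)
  (hk : exists k : nat,
      [/\ 1 <= k <= d,
          forall j, 1 <= j < k - 1 -> b j = z j %/ 2 - 1,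
          2 <= k -> odd (b (k - 1)) /\ 0 < b (k - 1) <= z (k - 1) %/ 2 - 1
        & forall j, k <= j <= d - 1 -> b j = 0])
  (h4 : 4 %| z d)
  (hA3 : coefA d z b 3 %| z 1)
  (hA : forall j, 2 <= j <= d - 1 -> 2 * coefA d z b (j + 2) %| z j) :
  exists H : 'I_(2 * \prod_(0 <= k < d - 1) (z (k + 1) %/ coefA d z b (k + 3))) ->
             subgraph (torus d z),
    decomposition H /\
    forall i,
      is_cycle (d * z d %/ 2 * \prod_(0 <= k < d - 1) coefA d z b (k + 3)) (H i) /\
      forall j : 'I_d,
        #|[set e in sedge (H i) | comes_from j e]|
        = z d %/ 2 * \prod_(0 <= k < d - 1) coefA d z b (k + 3).
Proof.
case: hk => k [k_int b_full b_mid b_zero].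
have z_gt0 j : 0 < j <= d -> 0 < z j by move=> /hz[].
have b_le j : 0 < j < d -> b j <= z j %/ 2 - 1.
  case/andP=> j0 ltj; have [ltk|gek] := ltnP j (k - 1); first by rewrite b_full ?j0.
  have [Ej|ne] := eqVneq j (k - 1); last by rewrite b_zero //; lia.
  by have [|_ /andP[_]] := b_mid; rewrite -?Ej; lia.
have A3 : coefA d z b 3 = 2 * (b 1 + 1).
  by apply: (coefA3E hz hd); apply: b_le.
have A j : 2 <= j < d -> coefA d z b (j + 2) = b j + 1.
  move=> j_int; apply: (coefAE hz j_int); rewrite /bx.
  case: (ltnP j.+1 d) => // ltj1; case: (ltnP j (k - 1)) => [ltk _|gek].
    by apply: b_full; lia.
  by rewrite (b_zero j.+1) //; lia.
rewrite A3 in hA3.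
have b_dvd j : 0 < j < d -> 2 * (b j + 1) %| z j.
  case/andP=> j0 ltj; have [->//|ne] := eqVneq j 1.
  by rewrite -A ?hA //; lia.
have b_cases j : 0 < j < d -> j != k - 1 -> b j + 1 = 1 \/ z j = 2 * (b j + 1).
  move=> j_int ne; have [ltk|gek] := ltnP j (k - 1); last by left; rewrite b_zero //; lia.
  right; rewrite b_full; last by lia.
  by have [|zj ezj] := hz j; lia.
have b_even j : 0 < j < d -> b j + 1 = 1 \/ ~~ odd (b j + 1).
  by case/andP=> j0 ltj; have [|ob|->] := hb j; [lia | right; rewrite addn1 /= negbK | left].
have Aprod : \prod_(0 <= i < d - 1) coefA d z b (i + 3)
    = 2 * (b 1 + 1) * \prod_(2 <= j < d) (b j + 1).
  rewrite big_ltn; last by lia.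
  rewrite A3; congr (_ * _); rewrite [RHS]big_add1 -subn1.
  apply: eq_big_nat => i i_int; rewrite -A; last by lia.
  by congr coefA; lia.
have mprod : 2 * \prod_(0 <= i < d - 1) (z (i + 1) %/ coefA d z b (i + 3))
    = z 1 %/ (b 1 + 1) * \prod_(2 <= j < d) (z j %/ (b j + 1)).
  rewrite big_ltn; last by lia.
  rewrite A3 mulnA muln_divA // divnMl //; congr (_ * _).
  rewrite [RHS]big_add1 -subn1.
  apply: eq_big_nat => i i_int; rewrite -A; last by lia.
  by rewrite addn1; congr (_ %/ coefA _ _ _ _); lia.
rewrite {}mprod {}Aprod.
clear b_full b_mid b_zero b_le hb hA A A3.
case: d hd hz h4 k_int z_gt0 b_dvd b_cases b_even => // -[//|D].
set d := D.+2 => _ hz h4 k_int z_gt0 b_dvd b_cases b_even.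
(* The index in the product and the index of [z] differ in the first two
   positions: [z 1] is at 0, and [z d] at 1. *)
pose axis i := if i == 0 then 1 else i.
pose al (i : 'I_d) := if i == 1 :> nat then z d else b (axis i) + 1.
pose len (i : 'I_d) := torus_len d z i.
have lenE (i : 'I_d) : len i = if i == 1 :> nat then z d else z (axis i).
  by rewrite /len; case: i => [[|[|i]] lti].
have axis_int (i : 'I_d) : i != 1 :> nat -> 0 < axis i < d.
  by case: i => [[|i] lti].
pose p : 'I_d := inord 1.
have p1 : p = 1 :> nat by rewrite inordK.
(* The distinguished direction is that of [b_(k-1)].  If [k = 1] there is none:
   then all the [a_j] are 1, and the first position serves as well. *)
pose q : 'I_d := inord (if k <= 2 then 0 else k - 1).
have qE : q = (if k <= 2 then 0 else k - 1) :> nat by rewrite inordK //; case: (leqP k 2); lia.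
have q1 : q != 1 :> nat by rewrite qE; case: (leqP k 2); lia.
have al1 (i : 'I_d) : i != 1 :> nat -> al i = b (axis i) + 1 /\ len i = z (axis i).
  by move=> /negPf ne; rewrite lenE /al ne.
have [|||||||||H [decH cycH]] := @fair_torus_decomposition D.+1 len al p q.
- by apply: contra q1 => /eqP <-; rewrite p1.
- move=> i; rewrite lenE; case: eqP => [_|/eqP/axis_int]; first by apply: z_gt0; lia.
  by move=> ax; apply: z_gt0; lia.
- move=> i; rewrite lenE dvdn2; case: eqP => [_|/eqP/axis_int].
    by have [|_ ->] := hz d; first lia.
  by move=> /andP[ax0 axd]; have [|_ ->] := hz (axis i); first by rewrite ax0 ltnW.
- move=> i; rewrite /al; case: eqP => _; last by rewrite addn1.
  by apply: z_gt0; lia.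
- by rewrite lenE /al p1.
- by rewrite lenE p1.
- by have [-> ->] := al1 q q1; apply/b_dvd/axis_int.
- by have [-> _] := al1 q q1; apply/b_even/axis_int.
- move=> i np nq; have ni1 : i != 1 :> nat by apply: contra np => /eqP i1; apply/eqP/val_inj; rewrite /= p1.
  have [-> ->] := al1 i ni1; apply: b_cases; first exact: axis_int.
  apply: contra nq => /eqP Ek; apply/eqP/val_inj; rewrite /= qE.
  move: Ek ni1; rewrite /axis; case: (nat_of_ord i) => [|[|n]] //= Ek _;
    by case: (leqP k 2); lia.
have prod_al : \prod_i al i = z d %/ 2 * (2 * (b 1 + 1) * \prod_(2 <= j < d) (b j + 1)).
  rewrite -(big_mkord xpredT (fun i => if i == 1 then z d else b (axis i) + 1)).
  rewrite big_ltn // [X in _ * X]big_ltn //=.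
  rewrite (@eq_big_nat _ _ _ _ _ _ (fun j => b j + 1)) => [|[|[|j]] //].
  have Ezd : z d = z d %/ 2 * 2 by have [|zd ezd] := hz d; lia.
  by rewrite /axis /= [in LHS]Ezd; lia.
have prod_m : \prod_i (len i %/ al i) = z 1 %/ (b 1 + 1) * \prod_(2 <= j < d) (z j %/ (b j + 1)).
  rewrite -(big_mkord xpredT (fun i =>
    torus_len d z i %/ (if i == 1 then z d else b (axis i) + 1))).
  rewrite big_ltn // [X in _ * X]big_ltn //=.
  rewrite (@eq_big_nat _ _ _ _ _ _ (fun j => z j %/ (b j + 1))) => [|[|[|j]] //].
  by rewrite divnn z_gt0 ?mul1n //; lia.
rewrite -prod_m; exists H; split=> // i; have [cycHi cntHi] := cycH i.
rewrite -prod_al; split=> //.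
suff -> : d * z d %/ 2 * (2 * (b 1 + 1) * \prod_(2 <= j < d) (b j + 1)) = d * \prod_i al i by [].
by rewrite prod_al -muln_divA ?mulnA //; have [|zd ezd] := hz d; lia.
Qed.
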